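(* For $c\geq 3$ let $K(c)$ be the set of 2-bridge knots with crossing number $c$, each counted exactly once (a knot and its mirror image not being counted separately), and let $k(c,\leq x)$ be the number of knots in $K(c)$ with signature at most $x$, counted as specified in the context. Then for every real number $t$, $$\lim_{c\to\infty}\frac{k\left(c,\,\leq t\sqrt{c}\right)}{|K(c)|}=\Phi(t),\qquad \Phi(t)=\frac{1}{\sqrt{2\pi}}\int_{-\infty}^t e^{-x^2/2}\,dx .$$ That is, over $K(c)$ the distribution of signatures is asymptotically normal with mean $0$ and variance $c$ as $c\to\infty$.
   Context: **The set $T(c)$.** For $c\ge 3$, $T(c)$ is the set of words in the symbols $\{+,-\}$ consisting of exactly $c$ maximal runs, of lengths $\varepsilon_1,\dots,\varepsilon_c\in\{1,2\}$, beginning with a run of $+$ (so the $i$-th run is of $+$ for $i$ odd and of $-$ for $i$ even), with $\varepsilon_1=\varepsilon_c=1$ and $\sum_{i=1}^c\varepsilon_i\equiv 1 \pmod 3$. **The knot of a word.** Replace the runs in order by braid letters: the runs $+$ and $--$ become $\sigma_1$, and the runs $-$ and $++$ become $\sigma_2^{-1}$. Draw four horizontal strands at heights $-1,0,1,2$, read left to right. A letter $\sigma_1$ is a crossing between heights $0$ and $1$ in which the strand of positive slope passes over; a letter $\sigma_2^{-1}$ is a crossing between heights $1$ and $2$ in which the strand of negative slope passes over; the strand at height $-1$ has no crossings. On the left, join height $1$ to height $2$ and height $-1$ to height $0$ by arcs. On the right, if $c$ is odd (last letter $\sigma_1$) join $1$ to $2$ and $-1$ to $0$; if $c$ is even (last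 letter $\sigma_2^{-1}$) join $0$ to $1$ and $-1$ to $2$ by nested arcs. The result is an alternating diagram of a 2-bridge knot with crossing number $c$. **Signature.** The signature of a knot is the signature (number of positive minus number of negative eigenvalues) of $V+V^T$ for a Seifert matrix $V$, with the sign convention that the right-handed (positive) trefoil has signature $-2$. It is always an even integer. Write $s(c,\sigma)$ for the number of words in $T(c)$ whose knot has signature $\sigma$. **Double counting.** Reversing the sequence $(\varepsilon_1,\dots,\varepsilon_c)$ is an involution on $T(c)$. It corresponds to reversing the word if $c$ is odd, and to reversing the word and exchanging $+$ and $-$ if $c$ is even. The two words represent the same knot if $c$ is odd, and mirror-image knots if $c$ is even. Up to mirror image, every 2-bridge knot with crossing number $c$ is represented by exactly one orbit of this involution. Let $T_p(c)\subseteq T(c)$ be the set of palindromic words, i.e. those with $\varepsilon_i=\varepsilon_{c+1-i}$ for all $i$, and let $s_p(c,\sigma)$ be the number of words in $T_p(c)$ whose knot has signature $\sigma$. **The counts over $K(c)$.** $K(c)$ is the set of 2-bridge knots with crossing number $c$, with chiral pairs not counted separately; equivalently, the set of orbits above, so $|K(c)|=\tfrac12\left(|T(c)|+|T_p(c)|\right)$. The number of knots in $K(c)$ with signature $\sigma$ is $$k(c,\sigma)=\tfrac12\left(s(c,\sigma)+s_p(c,\sigma)\right),$$ and $k(c,\leq x)=\sum_{\sigma\leq x}k(c,\sigma)$. (For odd $c$ this counts orbits by the common signature of their words; for even $c$ a two-element orbit, whose words have signatures $\sigma$ and $-\sigma$, contributes weight $\tfrac12$ to each of these values.) *)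

(* Defs.v *)
From HB Require Import structures.
From mathcomp Require Import all_boot all_order all_algebra all_field.
From mathcomp Require Import all_classical all_reals all_analysis.

Set Implicit Arguments.
Unset Strict Implicit.
Unset Printing Implicit Defensive.

Import Order.TTheory GRing.Theory Num.Theory.
Import numFieldNormedType.Exports.

Local Open Scope ring_scope.

(** ** Words *)

(* Words in {+,-} are sequences of booleans, [true] standing for +.  A run is
   recorded as its symbol together with its length. *)
Fixpoint runs (w : seq bool) : seq (bool * nat) :=
  if w is x :: w' then
    if runs w' is (y, m) :: r then
      if x == y then (x, m.+1) :: r else (x, 1%N) :: (y, m) :: r
    else [:: (x, 1%N)]
  else [::].

Definition run_lengths (w : seq bool) : seq nat := [seq p.2 | p <- runs w].

Definition in_T (c : nat) (w : seq bool) : bool :=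
  let e := run_lengths w in
  [&& size e == c, head false w, all (fun m => (m == 1) || (m == 2))%N e,
      head 0%N e == 1%N, last 0%N e == 1%N & (sumn e %% 3 == 1)%N].

(* A word with c runs of length at most 2 has length at most 2c, so T(c) is
   fully contained in the finite type of words of length at most 2c. *)
Definition T_words (c : nat) : {set (c.*2).-bseq bool} :=
  [set w : (c.*2).-bseq bool | in_T c w].

Definition Tp_words (c : nat) : {set (c.*2).-bseq bool} :=
  [set w in T_words c | rev (run_lengths w) == run_lengths w].

(* [rev_orbit w] is the orbit of w under reversal of (e_1, ..., e_c); a word of
   T(c) is determined by its run lengths. *)
Definition rev_orbit (c : nat) (w : (c.*2).-bseq bool) :
    {set (c.*2).-bseq bool} :=
  [set v in T_words c | (run_lengths v == run_lengths w)
                        || (run_lengths v == rev (run_lengths w))].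

Definition K_knots (c : nat) : {set {set (c.*2).-bseq bool}} :=
  [set rev_orbit w | w in T_words c].

(** ** Seifert matrices of oriented diagrams *)

(* The four corners at a crossing, seen along the direction in which both
   strands travel, are front, back, left and right; the left one is not
   needed. *)
Record crossing (region : Type) := Crossing {
  positive : bool;
  front : region;
  back : region;
  right_side : region }.

Section SeifertMatrix.
Variables (region : finType) (D : seq (crossing region)).

(* Smoothing a crossing along the orientation joins its front and back
   regions, so the connected components of this relation are the components of
   the sphere minus the Seifert circles. *)
Definition smoothing_rel : rel region := fun f g =>
  has (fun x => (f == front x) && (g == back x)
             || (g == front x) && (f == back x)) D.

(* Let F be the surface of Seifert's algorithm: disjoint discs standing as
   domes above the Seifert circles, and a half-twisted band at each crossing.
   The boundary of a region f, oriented counterclockwise, is a loop on F made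
   of arcs of Seifert circles and cores of bands.  In each component of the
   sphere minus the Seifert circles these loops have sum 0, and leaving out one
   loop per component gives a basis of H_1(F).  Here the canonical
   representative of each component is left out; elements of [region] that are
   incident to no crossing are alone in their component, hence left out too. *)
Definition loops : {set region} :=
  [set f | fingraph.root smoothing_rel f != f].

(* The linking number of the loop of f with the loop of g pushed off F in the
   positive normal direction.  It is the number of signed intersections of the
   planar region f with the push-off.  At a crossing, the loop of g runs through
   the band from left to right if g is in front, and from right to left if g
   is behind.  When run from left to right, the push-off leaves the upper
   half-space through the front region if the crossing is positive (through the
   back region if it is negative), passes below the band, and comes back
   through the region on the right. *)
Definition seifert_linking (f g : region) : int :=
  \sum_(x <- D)
    ((g == front x)%:Z - (g == back x)%:Z)
    * ((f == right_side x)%:Z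
       - (f == if positive x then front x else back x)%:Z).

Definition seifert_matrix : 'M[int]_#|loops| :=
  \matrix_(i, j) seifert_linking (enum_val i) (enum_val j).

End SeifertMatrix.

(** ** Signature *)

(* Eigenvalues with their algebraic multiplicities. *)
Definition eigenvalues (n : nat) (A : 'M[algC]_n) : seq algC :=
  sval (closed_field_poly_normal (char_poly A)).

(* On [algC], [0 < z] and [z < 0] imply that z is real. *)
Definition mx_signature (n : nat) (A : 'M[int]_n) : int :=
  let ev := eigenvalues (map_mx (fun m : int => m%:~R : algC) A) in
  (count (fun z => 0 < z) ev)%:Z - (count (fun z => z < 0) ev)%:Z.

Definition diagram_signature (region : finType) (D : seq (crossing region)) :
    int :=
  mx_signature (seifert_matrix D + (seifert_matrix D)^T).

(** ** The diagram of a word *)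

Inductive letter := sigma1 | sigma2V.

Definition run_letter (p : bool * nat) : letter :=
  match p with
  | (true, 1%N) | (false, 2%N) => sigma1
  | _ => sigma2V
  end.

Definition braid_word (w : seq bool) : seq letter :=
  [seq run_letter p | p <- runs w].

(* The strands at heights -1, 0, 1, 2 are numbered 0, 1, 2, 3.  The five gaps
   around them are numbered from 0 (below height -1) to 4 (above height 2), so
   that gap l lies between the strands l - 1 and l. *)
Definition gap (a : letter) : nat := (if a is sigma1 then 2 else 3)%N.

Section PlatDiagram.
Variable L : seq letter.

Local Notation n := (size L).
Local Notation lett j := (nth sigma1 L j).

(* The cell (j, l) is the part of gap l between the j-th and the (j+1)-st
   crossing (j = 0 at the left end, j = n at the right end); a region of the
   diagram is a union of cells. *)
Definition cell : finType := ('I_n.+1 * 'I_5)%type.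

(* On the left, the arcs joining the heights 1, 2 and -1, 0 close the gaps 3
   and 1 and leave the gaps 0, 2, 4 connected outside; similarly on the right
   for odd n.  For even n the arc joining 0, 1 closes gap 2, and the gaps 1 and
   3 are connected between the nested arcs. *)
Definition joined_left (l l' : nat) : bool := ~~ odd l && ~~ odd l'.

Definition joined_right (l l' : nat) : bool :=
  if odd n then ~~ odd l && ~~ odd l'
  else (l \in [:: 0; 4]%N) && (l' \in [:: 0; 4]%N)
    || (l \in [:: 1; 3]%N) && (l' \in [:: 1; 3]%N).

Definition cell_adj (x y : cell) : bool :=
  [|| [&& y.1 == x.1.+1 :> nat, x.2 == y.2 & gap (lett x.1) != x.2],
      [&& x.1 == 0%N :> nat, y.1 == 0%N :> nat & joined_left x.2 y.2]
    | [&& x.1 == n :> nat, y.1 == n :> nat & joined_right x.2 y.2]].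

Definition glued : rel cell := fun x y => cell_adj x y || cell_adj y x.

(* A region is represented by the canonical cell in it. *)
Definition region_at (j l : nat) : cell :=
  fingraph.root glued (inord j, inord l).

(* Each letter exchanges the two strands around its gap; [left_end j h] is the
   height at the left end of the strand that has height h just after the first
   j crossings. *)
Definition exchange (a : letter) (h : nat) : nat :=
  if h == (gap a).-1 then gap a else if h == gap a then (gap a).-1 else h.

Definition left_end (j h : nat) : nat := foldr exchange h (take j L).

(* Whether a strand is directed to the right, where strand 3 is directed to the
   right at the left end and b is the direction of strand 1 there; the left
   arcs force the other two directions. *)
Definition rightward (b : bool) (j h : nat) : bool :=
  nth false [:: ~~ b; b; false; true] (left_end j h).

Definition coherent (b : bool) : bool :=
  if odd n then (rightward b n 2 != rightward b n 3)
                && (rightward b n 0 != rightward b n 1)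
  else (rightward b n 1 != rightward b n 2)
       && (rightward b n 0 != rightward b n 3).

(* If the diagram is one of a knot, exactly one value of b is coherent with the
   right arcs, namely [coherent true]. *)
Definition directed (j h : nat) : bool := rightward (coherent true) j h.

Definition crossing_at (j : nat) : crossing cell :=
  let a := lett j in
  let l := gap a in
  let east := region_at j.+1 l in
  let west := region_at j l in
  let north := region_at j l.+1 in
  let south := region_at j l.-1 in
  (* the strand of positive slope starts below the one of negative slope *)
  let up := directed j l.-1 in
  let down := directed j l in
  let pos := if a is sigma1 then up != down else up == down in
  match up, down with
  | true, true => Crossing pos east west south
  | true, false => Crossing pos north south east
  | false, true => Crossing pos south north west
  | false, false => Crossing pos west east north
  end.

Definition plat_diagram : seq (crossing cell) :=
  [seq crossing_at j | j <- iota 0 n].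

End PlatDiagram.

Definition knot_signature (w : seq bool) : int :=
  diagram_signature (plat_diagram (braid_word w)).

(** ** Counts *)

Definition s_count (c : nat) (sigma : int) : nat :=
  #|[set w in T_words c | knot_signature w == sigma]|.

Definition sp_count (c : nat) (sigma : int) : nat :=
  #|[set w in Tp_words c | knot_signature w == sigma]|.

Definition k_count (R : realType) (c : nat) (sigma : int) : R :=
  (s_count c sigma + sp_count c sigma)%:R / 2.

(* Only finitely many terms are nonzero. *)
Definition k_le (R : realType) (c : nat) (x : R) : R :=
  \sum_(sigma \in [set sigma : int | sigma%:~R <= x]%classic) k_count R c sigma.

Definition Phi (R : realType) (t : R) : R :=
  (Num.sqrt (2 * pi))^-1
  * \int[lebesgue_measure]_(x in `]-oo, t]%classic) expR (- (x ^+ 2 / 2)).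

(* Main.v *)
(* Write down V + V^T as a quadratic form on the functions v on the regions of the
   plat diagram.  For the orientations of the knots of T(c), two of the three strands
   that cross are parallel and the third, odd one is opposite to them; let
   p in {1, 2, 3} be its position, counted from below.  Let x be the difference of v
   between the gap under height 1 and the outer region, and y the one between the gap
   above height 1 and the gap under height 0.  Telescoping along the oriented strands
   turns the form into a sum of local terms in which sums of squares of the x's appear
   with sign +, sums of squares of the y's with sign -, and all other terms are
   products x y.  So the signature is the number of x's minus the number of y's that
   occur, and counting these shows that it differs by a bounded amount from a sum of
   signs delta_j = +-1, one for each letter, for which p follows the walk
   p -> p + delta_j clamped to {1, 2, 3}.

   Because of the congruence mod 3, T(c) corresponds bijectively to the sign sequences
   of length c - 2 for which this walk goes from 3 to 3 (c odd) or from 3 to 1 (c even).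
   The transfer matrix of the clamped walk, with a variable z for the sum of the signs,
   has the eigenvalues z + 1/z, 1 and -1, so the number N_n of these sequences of
   length n with sum at most s satisfies N_(n+2)(s) = N_n(s) + W_n(s -+ 2), where W_n
   counts all sign sequences.  Hence N_n / 2^n tends to Phi / 3 by the central limit
   theorem for the simple random walk, which follows from the one-step comparison of
   the walk with the solution Phi(x / sqrt s) of the heat equation.  The palindromic
   words are negligible. *)
Require Import Defs.
From HB Require Import structures.
From mathcomp Require Import all_boot all_order all_algebra all_field.
From mathcomp Require Import ring lra zify.

Set Implicit Arguments.
Unset Strict Implicit.
Unset Printing Implicit Defensive.

Import Order.TTheory GRing.Theory Num.Theory.

(** * Inertia of symmetric integer matrices *)

Section Spectrum.
Local Open Scope ring_scope.
Local Open Scope sesquilinear_scope.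
Variables (n : nat).
Implicit Types (A P : 'M[algC]_n) (d : 'rV[algC]_n).

Lemma char_poly_similar_diag A P d : P \in unitmx ->
  A = invmx P *m diag_mx d *m P -> char_poly A = \prod_(i < n) ('X - (d 0 i)%:P).
Proof.
move=> Pu ->; transitivity (char_poly (diag_mx d)); last first.
  rewrite char_poly_trig ?diag_mx_is_trig//.
  by apply: eq_bigr => i _; rewrite mxE eqxx.
have PP : map_mx polyC (invmx P) *m map_mx polyC P = 1%:M.
  by rewrite -map_mxM mulVmx// map_mx1.
rewrite /char_poly -[RHS]mul1r -(det1 _ n) -PP det_mulmx mulrAC -!det_mulmx.
congr (\det _); rewrite /char_poly_mx mulmxBr mulmxBl !map_mxM; congr (_ - _).
by rewrite mul_mx_scalar -scalemxAl PP -mul_scalar_mx mulmx1.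
Qed.

Lemma eigenvalues_similar_diag A P d : P \in unitmx ->
  A = invmx P *m diag_mx d *m P -> perm_eq (eigenvalues A) [seq d 0 i | i <- enum 'I_n].
Proof.
move=> Pu AE; rewrite /eigenvalues.
case: closed_field_poly_normal => /= r.
rewrite (monicP (char_poly_monic A)) scale1r (char_poly_similar_diag Pu AE) => E.
apply/allP => x _ /=; rewrite -!mu_prod_XsubC -E big_map big_enum /=.
by rewrite big_mkcond.
Qed.

Definition npos A := count (fun z => 0 < z) (eigenvalues A).
Definition nneg A := count (fun z => z < 0) (eigenvalues A).

Lemma npos_similar_diag A P d : P \in unitmx ->
  A = invmx P *m diag_mx d *m P -> npos A = #|[set i | 0 < d 0 i]|.
Proof.
move=> Pu /(eigenvalues_similar_diag Pu) /permP; rewrite /npos => ->.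
rewrite count_map -sum1_count -sum1_card big_enum_cond /=.
by apply: eq_bigl => i; rewrite inE.
Qed.

Lemma nneg_similar_diag A P d : P \in unitmx ->
  A = invmx P *m diag_mx d *m P -> nneg A = #|[set i | d 0 i < 0]|.
Proof.
move=> Pu /(eigenvalues_similar_diag Pu) /permP; rewrite /nneg => ->.
rewrite count_map -sum1_count -sum1_card big_enum_cond /=.
by apply: eq_bigl => i; rewrite inE.
Qed.

Definition qform A (v : 'rV[algC]_n) : algC := (v *m A *m v^t*) 0 0.

Lemma qform_spectral A P d c : P \is unitarymx ->
  A = invmx P *m diag_mx d *m P ->
  qform A (c *m P) = \sum_i d 0 i * `|c 0 i| ^+ 2.
Proof.
move=> Pu ->; rewrite /qform invmx_unitary//.
have PP := unitarymxP Pu.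
rewrite trmx_mul map_mxM !mulmxA -[c *m P *m _]mulmxA PP mulmx1.
rewrite -[_ *m P *m _]mulmxA PP mulmx1 mul_mx_diag mxE.
by apply: eq_bigr => i _; rewrite !mxE normCK mulrAC mulrC.
Qed.

(** When the rows of [P] are eigenvectors, the rows of [selmx S *m P] are those with index in
    [S]. *)
Definition selmx (S : {set 'I_n}) : 'M[algC]_(#|S|, n) := rowsub enum_val 1%:M.

Lemma selmxE (S : {set 'I_n}) (u : 'rV[algC]_#|S|) :
  (forall k, (u *m selmx S) 0 (enum_val k) = u 0 k)
  /\ (forall i, i \notin S -> (u *m selmx S) 0 i = 0).
Proof.
split=> [k|i iS]; rewrite mxE.
  rewrite (bigD1 k)//= !mxE eqxx mulr1 big1 ?addr0// => j jk.
  by rewrite !mxE (inj_eq enum_val_inj) (negbTE jk) mulr0.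
rewrite big1// => j _; rewrite !mxE.
by case: eqP => [E|_]; [move: iS; rewrite -E enum_valP|rewrite mulr0].
Qed.

Lemma qform_selmx A P d (S : {set 'I_n}) u : P \is unitarymx ->
  A = invmx P *m diag_mx d *m P ->
  qform A (u *m (selmx S *m P)) = \sum_k d 0 (enum_val k) * `|u 0 k| ^+ 2.
Proof.
move=> Pu AE; rewrite mulmxA (qform_spectral _ Pu AE).
have [uS uN] := selmxE u.
rewrite (bigID (mem S)) /= [X in _ + X]big1 ?addr0; last first.
  by move=> i /uN ->; rewrite normr0 expr0n mulr0.
by rewrite big_enum_val; apply: eq_bigr => k _; rewrite uS.
Qed.

Lemma rank_selmx P (S : {set 'I_n}) : P \is unitarymx -> \rank (selmx S *m P) = #|S|.
Proof.
move=> /unitarymx_unit; rewrite -row_free_unit => Pf; rewrite mxrankMfree//.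
apply/eqP; rewrite -/(row_free (selmx S)) -kermx_eq0; apply/rowV0P => u /sub_kermxP uS.
apply/rowP => k; have [<- _] := selmxE u.
by rewrite uS !mxE.
Qed.

(** A common nonzero vector of the two row spaces would have a form both positive and nonpositive.
    So they meet in 0 and their dimensions add up to at most [n]. *)
Lemma posdef_disjoint A m k (U : 'M[algC]_(m, n)) (W : 'M[algC]_(k, n)) :
  (forall u : 'rV_m, u != 0 -> 0 < qform A (u *m U)) ->
  (forall w : 'rV_k, qform A (w *m W) <= 0) ->
  (m + \rank W <= n)%N.
Proof.
move=> Upos Wneg.
have Ufree : \rank U = m.
  apply/eqP; rewrite -/(row_free U) -kermx_eq0; apply/rowV0P => u /sub_kermxP uU.
  apply/eqP/negP => /negP /Upos.
  by rewrite uU /qform mul0mx mul0mx mxE ltxx.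
have UW : (U :&: W = 0)%MS.
  apply/eqP/rowV0P => v; rewrite sub_capmx => /andP[/submxP[u vu] /submxP[w vw]].
  apply/eqP/negP => /negP v0.
  have u0 : u != 0 by apply: contraNneq v0 => u0; rewrite vu u0 mul0mx.
  have := Upos _ u0; rewrite -vu vw => /lt_le_trans /(_ (Wneg w)).
  by rewrite ltxx.
have := mxrank_sum_cap U W; rewrite UW mxrank0 addn0 Ufree => <-.
exact: rank_leq_col.
Qed.

Section Diagonalized.
Variables (A P : 'M[algC]_n) (d : 'rV[algC]_n).
Hypotheses (Pu : P \is unitarymx) (AE : A = invmx P *m diag_mx d *m P).
Hypothesis dreal : forall i, d 0 i \is Num.real.
Let S := [set i | 0 < d 0 i].

(** Compared with the span of the eigenvectors of nonpositive eigenvalues. *)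
Lemma pos_count_ge m (U : 'M[algC]_(m, n)) :
  (forall u : 'rV_m, u != 0 -> 0 < qform A (u *m U)) -> (m <= #|S|)%N.
Proof.
move=> Upos.
have := posdef_disjoint (W := selmx (~: S) *m P) Upos.
rewrite rank_selmx// => /(_ _)/wrap[w|].
  rewrite (qform_selmx _ Pu AE) sumr_le0// => k _.
  have := enum_valP k; rewrite !inE -real_leNgt ?real0// => dk.
  by rewrite mulr_le0_ge0// exprn_ge0.
by rewrite -[X in (_ <= X)%N](card_ord n) -(cardsC S) leq_add2r.
Qed.

(** The span of the eigenvectors of positive eigenvalues avoids the kernel of [C], whose codimension
    is at most [k]. *)
Lemma pos_count_le k (C : 'M[algC]_(n, k)) :
  (forall v : 'rV_n, v *m C = 0 -> qform A v <= 0) -> (#|S| <= k)%N.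
Proof.
move=> Cneg.
have Spos (u : 'rV_#|S|) : u != 0 -> 0 < qform A (u *m (selmx S *m P)).
  move=> u0; rewrite (qform_selmx _ Pu AE).
  have [i ui] : exists i, u 0 i != 0 by apply/rV0Pn.
  rewrite (bigD1 i)//= ltr_pwDl//.
    by rewrite mulr_gt0 ?exprn_gt0 ?normr_gt0//; have := enum_valP i; rewrite inE.
  apply: sumr_ge0 => j _; rewrite mulr_ge0 ?exprn_ge0// ltW//.
  by have := enum_valP j; rewrite inE.
have Cneg' (w : 'rV_n) : qform A (w *m kermx C) <= 0.
  by apply: Cneg; rewrite -mulmxA mulmx_ker mulmx0.
have := posdef_disjoint Spos Cneg'.
rewrite mxrank_ker; have := rank_leq_col C; have := rank_leq_row C; lia.
Qed.
End Diagonalized.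
End Spectrum.

(** * Inertia bounds from real test vectors *)

Section RealForm.
Local Open Scope ring_scope.
Local Open Scope sesquilinear_scope.
Variables (n : nat) (A : 'M[int]_n).
Hypothesis Asym : A^T = A.

Let AC : 'M[algC]_n := map_mx (fun m : int => m%:~R) A.

Definition rform (v : 'I_n -> algC) : algC :=
  \sum_i \sum_j (A i j)%:~R * (v i * v j).

Let AC_real i j : AC i j \is Num.real.
Proof. by rewrite mxE realz. Qed.

Let AC_herm : AC \is hermsymmx.
Proof.
apply: realsym_hermsym.
  by apply/is_hermitianmxP; rewrite expr0 scale1r map_mx_id// /AC map_trmx Asym.
by apply/mxOverP => i j.
Qed.

Let P := spectralmx AC.
Let d := spectral_diag AC.

Let Pu : P \is unitarymx. Proof. exact: spectral_unitarymx. Qed.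
Let ACE : AC = invmx P *m diag_mx d *m P.
Proof. exact/orthomx_spectralP/hermitian_normalmx. Qed.
Let ACNE : - AC = invmx P *m diag_mx (- d) *m P.
Proof. by rewrite raddfN /= mulmxN mulNmx -ACE. Qed.
Let dreal i : d 0 i \is Num.real.
Proof. exact: (mxOverP (hermitian_spectral_diag_real AC_herm)). Qed.
Let dNreal i : (- d) 0 i \is Num.real.
Proof. by rewrite mxE realN. Qed.

(** The mixed terms in real and imaginary parts cancel because [A] is symmetric; so it is enough to
    test the form on real vectors. *)
Let qformE (v : 'rV[algC]_n) :
  qform AC v = rform (fun i => 'Re (v 0 i)) + rform (fun i => 'Im (v 0 i)).
Proof.
have imz : \sum_i \sum_j (A i j)%:~R * ('Im (v 0 i) * 'Re (v 0 j) - 'Re (v 0 i) * 'Im (v 0 j))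
   = 0 :> algC.
  under eq_bigr => i _ do under eq_bigr => j _ do rewrite mulrBr.
  under eq_bigr => i _ do rewrite sumrB.
  rewrite sumrB [X in _ - X]exchange_big /= [X in _ - X](_ : _ =
    \sum_i \sum_j (A i j)%:~R * ('Im (v 0 i) * 'Re (v 0 j))) ?subrr//.
  apply: eq_bigr => i _; apply: eq_bigr => j _.
  by rewrite -{1}Asym mxE [in X in _ * X]mulrC.
rewrite /qform mxE /rform.
transitivity (\sum_i \sum_j (A i j)%:~R * (v 0 i * (v 0 j)^*)).
  rewrite exchange_big /=; apply: eq_bigr => j _; rewrite !mxE mulr_suml.
  by apply: eq_bigr => i _; rewrite mxE mulrCA mulrA.
pose F i j : algC := (A i j)%:~R * ('Re (v 0 i) * 'Re (v 0 j)).
pose G i j : algC := (A i j)%:~R * ('Im (v 0 i) * 'Im (v 0 j)).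
pose H i j : algC := (A i j)%:~R * ('Im (v 0 i) * 'Re (v 0 j) - 'Re (v 0 i) * 'Im (v 0 j)).
transitivity (\sum_i (\sum_j F i j + \sum_j G i j + 'i * \sum_j H i j)); last first.
  by rewrite !big_split /= -mulr_sumr imz mulr0 addr0.
apply: eq_bigr => i _; rewrite mulr_sumr -!big_split /=; apply: eq_bigr => j _.
rewrite /F /G /H {1}[v 0 i]Crect {1}[v 0 j]Crect rmorphD rmorphM /= conjCi.
rewrite !(CrealP (Creal_Re _)) !(CrealP (Creal_Im _)).
have := @sqrCi algC; move: 'i => ii i2.
set a := (A i j)%:~R; set x := 'Re (v 0 i); set y := 'Im (v 0 i).
set z := 'Re (v 0 j); set t := 'Im (v 0 j).
transitivity (a * (x * z - ii ^+ 2 * (y * t) + ii * (y * z - x * t))); first by ring.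
by rewrite i2; ring.
Qed.

Let Re_mul k m (u : 'rV[algC]_k) (U : 'I_k -> 'I_m -> algC) (i : 'I_m) :
  (forall a b, U a b \is Num.real) ->
  'Re ((u *m \matrix_(a, b) U a b) 0 i) = \sum_a 'Re (u 0 a) * U a i.
Proof.
move=> Ur; rewrite mxE raddf_sum /=; apply: eq_bigr => a _.
by rewrite mxE mulrC ReMl// mulrC.
Qed.

Let Im_mul k m (u : 'rV[algC]_k) (U : 'I_k -> 'I_m -> algC) (i : 'I_m) :
  (forall a b, U a b \is Num.real) ->
  'Im ((u *m \matrix_(a, b) U a b) 0 i) = \sum_a 'Im (u 0 a) * U a i.
Proof.
move=> Ur; rewrite mxE raddf_sum /=; apply: eq_bigr => a _.
by rewrite mxE mulrC ImMl// mulrC.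
Qed.

(** The sign [sg] makes one statement serve both indices of inertia. *)
Let form_pos k (sg : algC) (U : 'I_k -> 'I_n -> algC) :
  (forall a b, U a b \is Num.real) ->
  (forall u : 'I_k -> algC, (forall a, u a \is Num.real) -> (exists a, u a != 0) ->
     0 < sg * rform (fun i => \sum_a u a * U a i)) ->
  forall u : 'rV[algC]_k, u != 0 -> 0 < sg * qform AC (u *m \matrix_(a, b) U a b).
Proof.
move=> Ur Upos u u0; rewrite qformE mulrDr.
have eqf f g : f =1 g -> rform f = rform g.
  by move=> fg; apply: eq_bigr => i _; apply: eq_bigr => j _; rewrite !fg.
rewrite (eqf _ _ (fun i => Re_mul u i Ur)) (eqf _ _ (fun i => Im_mul u i Ur)).
have nonneg (r : 'I_k -> algC) : (forall a, r a \is Num.real) ->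
    0 <= sg * rform (fun i => \sum_a r a * U a i).
  move=> rr; have [/existsP ra|] := boolP [exists a, r a != 0].
    by rewrite ltW// Upos.
  rewrite negb_exists => /forallP r0.
  rewrite (eqf _ (fun=> 0)) => [|i]; last first.
    by apply: big1 => a _; have := r0 a; rewrite negbK => /eqP->; rewrite mul0r.
  rewrite /rform big1 ?mulr0// => i _; apply: big1 => j _.
  by rewrite !mulr0.
have [a ua] : exists a, u 0 a != 0 by apply/rV0Pn.
have rr b : 'Re (u 0 b) \is Num.real := Creal_Re _.
have ri b : 'Im (u 0 b) \is Num.real := Creal_Im _.
have [ra|ra] := eqVneq ('Re (u 0 a)) 0; last first.
  by apply: ltr_pwDl; [apply: Upos => //; exists a|exact: nonneg].
apply: ltr_wpDl; [exact: nonneg|apply: Upos => //; exists a].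
by apply: contraNneq ua => ia; rewrite [u 0 a]Crect ra ia mulr0 addr0.
Qed.

Let form_neg k (sg : algC) (C : 'I_n -> 'I_k -> algC) :
  (forall a b, C a b \is Num.real) ->
  (forall v : 'I_n -> algC, (forall a, v a \is Num.real) ->
     (forall b, \sum_a v a * C a b = 0) -> sg * rform v <= 0) ->
  forall v : 'rV[algC]_n, v *m (\matrix_(a, b) C a b) = 0 -> sg * qform AC v <= 0.
Proof.
move=> Cr Cneg v vC; rewrite qformE mulrDr.
have ReC b : \sum_a 'Re (v 0 a) * C a b = 0 by rewrite -Re_mul// vC mxE raddf0.
have ImC b : \sum_a 'Im (v 0 a) * C a b = 0 by rewrite -Im_mul// vC mxE raddf0.
have rr b : 'Re (v 0 b) \is Num.real := Creal_Re _.
have ri b : 'Im (v 0 b) \is Num.real := Creal_Im _.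
by rewrite -[leRHS]addr0 lerD// Cneg.
Qed.

Let qformN (B : 'M[algC]_n) v : qform (- B) v = -1 * qform B v.
Proof. by rewrite /qform mulmxN mulNmx mxE mulN1r. Qed.

Lemma npos_ge k (U : 'I_k -> 'I_n -> algC) :
  (forall a b, U a b \is Num.real) ->
  (forall u : 'I_k -> algC, (forall a, u a \is Num.real) -> (exists a, u a != 0) ->
     0 < rform (fun i => \sum_a u a * U a i)) ->
  (k <= npos AC)%N.
Proof.
move=> Ur Upos; rewrite (npos_similar_diag (unitarymx_unit Pu) ACE).
apply: (pos_count_ge Pu ACE) => // u u0.
by have := form_pos (sg := 1) Ur _ u0; rewrite mul1r; apply => ? ? ?; rewrite mul1r Upos.
Qed.

Lemma nneg_ge k (U : 'I_k -> 'I_n -> algC) :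
  (forall a b, U a b \is Num.real) ->
  (forall u : 'I_k -> algC, (forall a, u a \is Num.real) -> (exists a, u a != 0) ->
     rform (fun i => \sum_a u a * U a i) < 0) ->
  (k <= nneg AC)%N.
Proof.
move=> Ur Upos; rewrite (nneg_similar_diag (unitarymx_unit Pu) ACE).
(* Negative eigenvalues are the positive ones of [- AC], which the same [P] diagonalizes. *)
have -> : [set i | d 0 i < 0] = [set i | 0 < (- d) 0 i].
  by apply/setP => i; rewrite !inE mxE oppr_gt0.
apply: (pos_count_ge Pu ACNE dNreal) => u u0; rewrite qformN.
by apply: form_pos => // ? ? ?; rewrite mulN1r oppr_gt0 Upos.
Qed.

Lemma npos_le k (C : 'I_n -> 'I_k -> algC) :
  (forall a b, C a b \is Num.real) ->
  (forall v : 'I_n -> algC, (forall a, v a \is Num.real) ->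
     (forall b, \sum_a v a * C a b = 0) -> rform v <= 0) ->
  (npos AC <= k)%N.
Proof.
move=> Cr Cneg; rewrite (npos_similar_diag (unitarymx_unit Pu) ACE).
apply: (pos_count_le Pu ACE (C := \matrix_(a, b) C a b)) => v vC.
rewrite -[qform _ _]mul1r; apply: (form_neg Cr _ vC) => w wr wC.
by rewrite mul1r Cneg.
Qed.

Lemma nneg_le k (C : 'I_n -> 'I_k -> algC) :
  (forall a b, C a b \is Num.real) ->
  (forall v : 'I_n -> algC, (forall a, v a \is Num.real) ->
     (forall b, \sum_a v a * C a b = 0) -> 0 <= rform v) ->
  (nneg AC <= k)%N.
Proof.
move=> Cr Cneg; rewrite (nneg_similar_diag (unitarymx_unit Pu) ACE).
have -> : [set i | d 0 i < 0] = [set i | 0 < (- d) 0 i].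
  by apply/setP => i; rewrite !inE mxE oppr_gt0.
apply: (pos_count_le Pu ACNE (C := \matrix_(a, b) C a b)) => v vC; rewrite qformN.
apply: (form_neg Cr _ vC) => w wr wC.
by rewrite mulN1r oppr_le0 Cneg.
Qed.

End RealForm.

(** * The Seifert form as a function of the regions *)

Section SeifertForm.
Local Open Scope ring_scope.
Variables (region : finType) (D : seq (crossing region)).

Definition pushed_side (x : crossing region) : region :=
  if positive x then front x else back x.

Definition seifert_form (V : region -> algC) : algC :=
  \sum_(x <- D) (V (front x) - V (back x)) * (V (right_side x) - V (pushed_side x)).

Lemma eq_seifert_form V W : V =1 W -> seifert_form V = seifert_form W.
Proof. by move=> VW; apply: eq_bigr => x _; rewrite !VW. Qed.

Let n := #|loops D|.
Let M := seifert_matrix D.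

(** Coordinates on the basis loops become a function on all regions, zero on the loops left out, so
    that the form can be summed over the crossings. *)
Definition extend (v : 'I_n -> algC) (f : region) : algC :=
  \sum_i v i * (enum_val i == f)%:R.

Lemma extend_enum_val v i : extend v (enum_val i) = v i.
Proof.
rewrite /extend (bigD1 i)//= eqxx mulr1 big1 ?addr0// => j ji.
by rewrite (inj_eq enum_val_inj) (negbTE ji) mulr0.
Qed.

Lemma extend_notin v f : f \notin loops D -> extend v f = 0.
Proof.
move=> fD; rewrite /extend big1// => i _.
by case: eqP => [E|]; rewrite ?mulr0//; move: fD; rewrite -E enum_valP.
Qed.

Lemma rform_seifert (v : 'I_n -> algC) :
  rform (M + M^T) v = 2 * seifert_form (extend v).
Proof.
have S : \sum_i \sum_j (M i j)%:~R * (v i * v j) = seifert_form (extend v).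
  transitivity (\sum_i \sum_j \sum_(x <- D)
     (v j * ((enum_val j == front x)%:R - (enum_val j == back x)%:R))
     * (v i * ((enum_val i == right_side x)%:R - (enum_val i == pushed_side x)%:R))).
    apply: eq_bigr => i _; apply: eq_bigr => j _.
    rewrite mxE /seifert_linking rmorph_sum /= mulr_suml; apply: eq_bigr => x _.
    rewrite rmorphM !rmorphB /= -!pmulrn; ring.
  under eq_bigr => i _ do rewrite exchange_big /=.
  rewrite exchange_big /=; apply: eq_bigr => x _.
  under eq_bigr => i _ do rewrite -mulr_suml.
  rewrite -mulr_sumr /extend -!sumrB; congr (_ * _); apply: eq_bigr => i _; ring.
rewrite /rform.
transitivity (\sum_i \sum_j (M i j)%:~R * (v i * v j)
            + \sum_i \sum_j (M j i)%:~R * (v j * v i)).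
  rewrite -big_split; apply: eq_bigr => i _; rewrite -big_split; apply: eq_bigr => j _.
  by rewrite !mxE rmorphD /= [v j * v i]mulrC -mulrDl.
by rewrite [X in _ + X]exchange_big /= S; ring.
Qed.

Lemma seifert_sym : (M + M^T)^T = M + M^T.
Proof. by rewrite linearD /= trmxK addrC. Qed.

Let A : 'M[algC]_n := map_mx (fun m : int => m%:~R) (M + M^T).

Let Num_bool_real (b c : bool) : (b%:R - c%:R : algC) \is Num.real.
Proof. by rewrite realB ?realn. Qed.

Let extend_real v : (forall i, v i \is Num.real) -> forall f, extend v f \is Num.real.
Proof. by move=> vr f; apply: sum_real => i _; rewrite realM ?realn. Qed.

Let pinned k (r1 r2 : 'I_k -> region) (v : 'I_n -> algC) b :
  \sum_i v i * ((enum_val i == r1 b)%:R - (enum_val i == r2 b)%:R) = 0 ->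
  extend v (r1 b) = extend v (r2 b).
Proof.
move=> E; apply/eqP; rewrite -subr_eq0 /extend -sumrB; apply/eqP; rewrite -[RHS]E.
by apply: eq_bigr => i _; rewrite mulrBr.
Qed.

(** The equations between values at two regions cut out a subspace of codimension at most [k]. *)
Lemma seifert_npos_le k (r1 r2 : 'I_k -> region) :
  (forall V : region -> algC, (forall f, V f \is Num.real) ->
     (forall b, V (r1 b) = V (r2 b)) -> seifert_form V <= 0) ->
  (npos A <= k)%N.
Proof.
move=> neg; apply: (npos_le seifert_sym
  (C := fun i b => (enum_val i == r1 b)%:R - (enum_val i == r2 b)%:R)) => // v vr vC.
rewrite rform_seifert pmulr_rle0//; apply: neg => [|b]; first exact: extend_real.
exact: pinned.
Qed.

Lemma seifert_nneg_le k (r1 r2 : 'I_k -> region) :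
  (forall V : region -> algC, (forall f, V f \is Num.real) ->
     (forall b, V (r1 b) = V (r2 b)) -> 0 <= seifert_form V) ->
  (nneg A <= k)%N.
Proof.
move=> neg; apply: (nneg_le seifert_sym
  (C := fun i b => (enum_val i == r1 b)%:R - (enum_val i == r2 b)%:R)) => // v vr vC.
rewrite rform_seifert pmulr_rge0//; apply: neg => [|b]; first exact: extend_real.
exact: pinned.
Qed.

(* This says that in each component of the complement of the Seifert circles the
   loops of the regions sum to 0, so that the loops left out of the basis do not
   matter. *)
Hypothesis smoothing_invariant : forall V s : region -> algC,
  (forall f g, smoothing_rel D f g -> s f = s g) ->
  seifert_form (fun f => V f + s f) = seifert_form V.

Let proot := fingraph.root (smoothing_rel D).

Let smoothing_connect_sym : connect_sym (smoothing_rel D).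
Proof.
apply: fingraph.sym_connect_sym => f g; apply: eq_has => x.
by rewrite orbC; congr (_ || _); rewrite andbC.
Qed.

Let proot_smoothing f g : smoothing_rel D f g -> proot f = proot g.
Proof. by move=> fg; apply/fingraph.rootP => //; apply: fingraph.connect1. Qed.

(** Subtracting from a function its value at the root of each component leaves the form unchanged
    and makes the function vanish on the loops left out. So any function on the regions may serve as
    a test vector. *)
Let reduced k (U : 'I_k -> region -> algC) (u : 'I_k -> algC) :
  rform (M + M^T) (fun i : 'I_n => \sum_a u a * (U a (enum_val i) - U a (proot (enum_val i))))
  = 2 * seifert_form (fun f => \sum_a u a * U a f).
Proof.
rewrite rform_seifert -(@smoothing_invariant (fun f => \sum_a u a * U a f)
  (fun f => - \sum_a u a * U a (proot f))); last first.
  by move=> f g /proot_smoothing ->.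
congr (_ * _); apply: eq_seifert_form => f.
have [fD|fD] := boolP (f \in loops D).
  rewrite -(enum_rankK_in fD fD) extend_enum_val -sumrB.
  by apply: eq_bigr => a _; rewrite mulrBr.
by rewrite extend_notin//; move: fD; rewrite inE negbK /proot => /eqP ->; rewrite subrr.
Qed.

Lemma seifert_npos_ge k (U : 'I_k -> region -> algC) :
  (forall a f, U a f \is Num.real) ->
  (forall u : 'I_k -> algC, (forall a, u a \is Num.real) -> (exists a, u a != 0) ->
     0 < seifert_form (fun f => \sum_a u a * U a f)) ->
  (k <= npos A)%N.
Proof.
move=> Ur Upos; apply: (npos_ge seifert_sym
  (U := fun a i => U a (enum_val i) - U a (proot (enum_val i)))) => [a i|u ur u0].
  exact: realB.
by rewrite reduced mulr_gt0// Upos.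
Qed.

Lemma seifert_nneg_ge k (U : 'I_k -> region -> algC) :
  (forall a f, U a f \is Num.real) ->
  (forall u : 'I_k -> algC, (forall a, u a \is Num.real) -> (exists a, u a != 0) ->
     seifert_form (fun f => \sum_a u a * U a f) < 0) ->
  (k <= nneg A)%N.
Proof.
move=> Ur Upos; apply: (nneg_ge seifert_sym
  (U := fun a i => U a (enum_val i) - U a (proot (enum_val i)))) => [a i|u ur u0].
  exact: realB.
by rewrite reduced pmulr_rlt0// Upos.
Qed.

End SeifertForm.

(** * The signature of a plat diagram *)

Definition is_sigma1 (a : letter) : bool := if a is sigma1 then true else false.

Section Plat.
Local Open Scope ring_scope.
Variable L : seq letter.
Local Notation n := (size L).
Local Notation lett j := (nth sigma1 L j).
Local Notation reg := (region_at L).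

Lemma glued_sym : connect_sym (@glued L).
Proof. by apply: fingraph.sym_connect_sym => c d; rewrite /glued orbC. Qed.

Lemma root_glued (c d : cell L) :
  cell_adj c d -> fingraph.root (@glued L) c = fingraph.root (@glued L) d.
Proof.
move=> cd; apply/fingraph.rootP; first exact: glued_sym.
by apply: fingraph.connect1; rewrite /glued cd.
Qed.

Lemma region_at_next j l : (j < n)%N -> (l < 5)%N -> gap (lett j) != l ->
  reg j.+1 l = reg j l.
Proof.
move=> jn l5 jl; apply/esym/root_glued; rewrite /cell_adj /=.
rewrite (@inordK _ l)// (@inordK _ j) ?(@inordK _ j.+1) ?eqxx//; last exact: ltnW.
by rewrite jl.
Qed.

Lemma region_at_left l l' : (l < 5)%N -> (l' < 5)%N -> joined_left l l' ->
  reg 0 l = reg 0 l'.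
Proof.
by move=> l5 l5' ll; apply: root_glued; rewrite /cell_adj /= !inordK// ll ?orbT.
Qed.

Lemma region_at_right l l' : (l < 5)%N -> (l' < 5)%N -> joined_right L l l' ->
  reg n l = reg n l'.
Proof.
by move=> l5 l5' ll; apply: root_glued; rewrite /cell_adj /= !inordK// ll eqxx !orbT.
Qed.

Lemma glued_invariant_root (T : Type) (v : cell L -> T) :
  (forall c d, cell_adj c d -> v c = v d) ->
  forall c, v (fingraph.root (@glued L) c) = v c.
Proof.
move=> vadj c; have /fingraph.connectP[p + ->] := fingraph.connect_root (@glued L) c.
by elim: p c => //= d p IH c /andP[/orP[cd|cd] /IH ->]; [rewrite (vadj _ _ cd)|rewrite (vadj _ _ cd)].
Qed.

(* For the orientations of the words of T(c), strand 0 and exactly one of the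
   strands 1, 2, 3 run to the right.  The latter starts as strand 3, and
   [odd_pos j] is its position after j crossings. *)
Definition odd_pos (j : nat) : nat := foldl (fun p a => exchange a p) 3 (take j L).

Lemma odd_pos0 : odd_pos 0 = 3. Proof. by rewrite /odd_pos take0. Qed.

Lemma odd_posS j : (j < n)%N -> odd_pos j.+1 = exchange (lett j) (odd_pos j).
Proof. by move=> jn; rewrite /odd_pos (take_nth sigma1 jn) foldl_rcons. Qed.

Lemma left_endS j h : (j < n)%N -> left_end L j.+1 h = left_end L j (exchange (lett j) h).
Proof. by move=> jn; rewrite /left_end (take_nth sigma1 jn) foldr_rcons. Qed.

Lemma odd_pos_range j : (j <= n)%N -> odd_pos j \in [:: 1; 2; 3]%N.
Proof.
elim: j => [|j IH] jn; first by rewrite odd_pos0.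
rewrite odd_posS//; move: (IH (ltnW jn)); rewrite !inE.
by case: (lett j) => /or3P[] /eqP ->.
Qed.

(** The orientation is thus the one with [b = false]: at the left end strands 0 and 3 run to the
    right, strands 1 and 2 to the left. *)
Hypothesis b_false : coherent L true = false.
Hypothesis coherent_false : coherent L false.

Lemma directedS j h : (j < n)%N ->
  directed L j.+1 h = directed L j (exchange (lett j) h).
Proof. by move=> jn; rewrite /directed /rightward left_endS. Qed.

Lemma directed0 h : directed L 0 h = nth false [:: true; false; false; true] h.
Proof. by rewrite /directed b_false /rightward /left_end take0. Qed.

Lemma directed_odd_pos j h : (j <= n)%N -> h \in [:: 1; 2; 3]%N ->
  directed L j h = (h == odd_pos j).
Proof.
elim: j h => [|j IH] h jn h3.
  by rewrite directed0 odd_pos0; move: h3; rewrite !inE => /or3P[] /eqP ->.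
have h3' : exchange (lett j) h \in [:: 1; 2; 3]%N.
  by move: h3; rewrite !inE; case: (lett j) => /or3P[] /eqP ->.
rewrite directedS// IH//; last exact: ltnW.
rewrite odd_posS//; move: (odd_pos_range (ltnW jn)) h3; rewrite !inE.
by case: (lett j) => /or3P[] /eqP -> /or3P[] /eqP ->.
Qed.

(** The fourth corner of the crossing, which the record [crossing] omits. *)
Definition left_side (j : nat) : cell L :=
  let l := gap (lett j) in
  match directed L j l.-1, directed L j l with
  | true, true => reg j l.+1
  | true, false => reg j l
  | false, true => reg j.+1 l
  | false, false => reg j l.-1
  end.

Section Telescope.
Variable phi : cell L -> cell L -> algC.

(** [phi] is taken at the regions to the left and to the right of the strand, with the sign of its
    passage through the vertical line. *)
Let strand_flux (d : bool) (above below : cell L) : algC :=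
  if d then phi above below else - phi below above.

Let flux (j : nat) : algC := \sum_(h < 4) strand_flux (directed L j h) (reg j h.+1) (reg j h).

(** The four terms belong to the four edges at the crossing, outgoing ones with sign + and incoming
    ones with sign -; the other two strands are the same on both sides. *)
Let flux_crossing j : (j < n)%N ->
  let x := crossing_at L j in
  phi (left_side j) (front x) + phi (front x) (right_side x)
  - phi (back x) (right_side x) - phi (left_side j) (back x) = flux j.+1 - flux j.
Proof.
move=> jn /=; rewrite /flux !big_ord_recr !big_ord0 /= !add0r /strand_flux.
rewrite !directedS//.
rewrite /crossing_at /left_side.
have H l := @region_at_next j l jn.
move: H; case: (lett j) => /= H.
- rewrite (H 0%N)// (H 1%N)// (H 3%N)// (H 4%N)// /exchange /=.
  by case: (directed L j 1); case: (directed L j 2) => /=; ring.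
- rewrite (H 0%N)// (H 1%N)// (H 2%N)// (H 4%N)// /exchange /=.
  by case: (directed L j 2); case: (directed L j 3) => /=; ring.
Qed.

(** The two ends of an arc have opposite directions and separate the same regions, so they
    cancel. *)
Let flux0 : flux 0 = 0.
Proof.
rewrite /flux !big_ord_recr big_ord0 /= !directed0 /strand_flux /=.
by rewrite (@region_at_left 2 0)// (@region_at_left 4 0)//; ring.
Qed.

Let fluxn : flux n = 0.
Proof.
rewrite /flux !big_ord_recr big_ord0 /= /strand_flux.
have := coherent_false; rewrite /coherent.
have E h : rightward L false n h = directed L n h by rewrite /directed b_false.
rewrite !E; have := @region_at_right; rewrite /joined_right.
case: (odd n) => R.
  rewrite (R 2 0)// (R 4 0)//.
  by do 4![case: (directed L n _)] => //= _; ring.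
rewrite (R 3 1)// (R 4 0)//.
by do 4![case: (directed L n _)] => //= _; ring.
Qed.

(* At each crossing this is the difference of the fluxes of [phi] across the
   vertical lines on both sides; the arcs at both ends make the first and the last
   flux vanish. *)
Lemma flux_sum : \sum_(0 <= j < n)
  (phi (left_side j) (front (crossing_at L j))
   + phi (front (crossing_at L j)) (right_side (crossing_at L j))
   - phi (back (crossing_at L j)) (right_side (crossing_at L j))
   - phi (left_side j) (back (crossing_at L j))) = 0.
Proof.
rewrite (eq_big_nat _ _ (F2 := fun j => flux j.+1 - flux j)) => [|j /andP[_ jn]].
  by rewrite telescope_sumr// fluxn flux0 subrr.
exact: flux_crossing.
Qed.
End Telescope.

Lemma seifert_form_nat (v : cell L -> algC) : seifert_form (plat_diagram L) v =
  \sum_(0 <= j < n) (v (front (crossing_at L j)) - v (back (crossing_at L j)))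
    * (v (right_side (crossing_at L j)) - v (pushed_side (crossing_at L j))).
Proof. by rewrite /seifert_form /plat_diagram big_map /index_iota subn0. Qed.

(** As [s] agrees in front of and behind each crossing, only the second factor of a term changes,
    and the total change is the flux sum for [v l * s r - v l * s l]. *)
Lemma plat_smoothing_invariant (v s : cell L -> algC) :
  (forall f g, smoothing_rel (plat_diagram L) f g -> s f = s g) ->
  seifert_form (plat_diagram L) (fun f => v f + s f) = seifert_form (plat_diagram L) v.
Proof.
move=> ss; rewrite !seifert_form_nat; apply/eqP; rewrite -subr_eq0 -sumrB; apply/eqP.
rewrite -[RHS](flux_sum (fun l r => v l * s r - v l * s l)).
apply: eq_big_nat => j /andP[_ jn].
have /ss sE : smoothing_rel (plat_diagram L) (front (crossing_at L j)) (back (crossing_at L j)).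
  rewrite /smoothing_rel has_map; apply/hasP; exists j; last by rewrite /= !eqxx.
  by rewrite mem_iota.
by rewrite /pushed_side; case: (positive _); rewrite sE; ring.
Qed.

(** * The form in the coordinates x and y *)

Definition xdiff (v : cell L -> algC) j := v (reg j 2) - v (reg 0 4).
Definition ydiff (v : cell L -> algC) j := v (reg j 3) - v (reg 0 1).

Lemma region_at_top j : (j <= n)%N -> reg j 4 = reg 0 4.
Proof.
elim: j => // j IH jn; rewrite -IH; last exact: ltnW.
by apply: region_at_next => //; case: (lett j).
Qed.

Lemma region_at_bottom j : (j <= n)%N -> reg j 1 = reg 0 1.
Proof.
elim: j => // j IH jn; rewrite -IH; last exact: ltnW.
by apply: region_at_next => //; case: (lett j).
Qed.

Lemma xdiff0 v : xdiff v 0 = 0.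
Proof. by rewrite /xdiff (@region_at_left 2 4)// subrr. Qed.

Lemma xdiffS v j : (j < n)%N -> ~~ is_sigma1 (lett j) -> xdiff v j.+1 = xdiff v j.
Proof. by move=> jn aj; rewrite /xdiff region_at_next//; case: (lett j) aj. Qed.

Lemma ydiffS v j : (j < n)%N -> is_sigma1 (lett j) -> ydiff v j.+1 = ydiff v j.
Proof. by move=> jn aj; rewrite /ydiff region_at_next//; case: (lett j) aj. Qed.

Lemma xdiff_end v : odd n -> xdiff v n = 0.
Proof.
move=> on; rewrite /xdiff -(region_at_top (leqnn n)) (@region_at_right 2 4) ?subrr//.
by rewrite /joined_right on.
Qed.

Lemma ydiff_end v : ~~ odd n -> ydiff v n = 0.
Proof.
move=> on; rewrite /ydiff -(region_at_bottom (leqnn n)) (@region_at_right 3 1) ?subrr//.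
Qed.

(* At positions 3 and 1 only the variable x, respectively y, matters; at position 2
   the next letter tells whether the odd strand goes on to 3 or to 1. *)
Definition x_phase (j : nat) : bool :=
  (odd_pos j == 3)%N || ((odd_pos j == 2)%N && ~~ is_sigma1 (lett j)).

(** [a] tells whether the letter is [sigma1], and [r], [r'] are the phases before and after it.
    Products of an x and a y occur only where the phase changes. *)
Definition step_form (a r r' : bool) (x y x' y' : algC) : algC :=
  if a then if r then (x' - x) ^+ 2 else if r' then 2 * x' * y - y ^+ 2 else - y ^+ 2
  else if r then if r' then x ^+ 2 else x ^+ 2 - 2 * x * y' else - (y' - y) ^+ 2.

Let phase_sign j : algC := if x_phase j then -1 else 1.

(* Besides the flux of [l * r - l ^ 2], the telescoping multiple of x * y whose sign
   depends on the phase cancels all cross terms except those where the phase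
   changes. *)
Lemma seifert_form_plat v : 2 * seifert_form (plat_diagram L) v =
  \sum_(0 <= j < n) step_form (is_sigma1 (lett j)) (x_phase j) (x_phase j.+1)
    (xdiff v j) (ydiff v j) (xdiff v j.+1) (ydiff v j.+1).
Proof.
pose c j := phase_sign j * xdiff v j * ydiff v j.
have cn : c n - c 0 = 0.
  rewrite /c xdiff0; have [on|on] := boolP (odd n).
    by rewrite xdiff_end//; ring.
  by rewrite ydiff_end//; ring.
transitivity (\sum_(0 <= j < n) (step_form (is_sigma1 (lett j)) (x_phase j) (x_phase j.+1)
    (xdiff v j) (ydiff v j) (xdiff v j.+1) (ydiff v j.+1) + (c j.+1 - c j) +
    let phi l r := v l * v r - v l * v l in
    (phi (left_side j) (front (crossing_at L j))
    + phi (front (crossing_at L j)) (right_side (crossing_at L j))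
    - phi (back (crossing_at L j)) (right_side (crossing_at L j))
    - phi (left_side j) (back (crossing_at L j))))); last first.
  rewrite big_split (flux_sum (fun l r => v l * v r - v l * v l)).
  by rewrite big_split /= telescope_sumr// cn !addr0.
rewrite seifert_form_nat mulr_sumr; apply: eq_big_nat => j /andP[_ jn].
rewrite /c /phase_sign /x_phase odd_posS//.
move: (is_sigma1 (lett j.+1)) => a'.
have H l := @region_at_next j l jn.
rewrite /crossing_at /left_side /xdiff /ydiff -(region_at_top (ltnW jn)) -(region_at_bottom (ltnW jn)).
rewrite ![directed L j _]directed_odd_pos ?(ltnW jn)//; try by case: (lett j).
have := odd_pos_range (ltnW jn); rewrite !inE.
move: H; case: (lett j) => /= H; [rewrite (H 3%N)//|rewrite (H 2%N)//].
all: rewrite /pushed_side => /or3P[] /eqP -> /=; case: a' => /=; ring.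
Qed.

Section PhaseSteps.
Variable j : nat.
Hypothesis jn : (j < n)%N.

(** [sigma1] fixes position 3 and [sigma2V] fixes position 1, so an x phase is left only at
    [sigma2V] and entered only at [sigma1]. *)
Lemma x_phase_keep : is_sigma1 (lett j) -> x_phase j -> x_phase j.+1.
Proof.
rewrite /x_phase odd_posS//; have := odd_pos_range (ltnW jn); rewrite !inE.
by case: (lett j) => // /or3P[] /eqP ->.
Qed.

Lemma y_phase_keep : ~~ is_sigma1 (lett j) -> ~~ x_phase j -> ~~ x_phase j.+1.
Proof.
rewrite /x_phase odd_posS//; have := odd_pos_range (ltnW jn); rewrite !inE.
by case: (lett j) => // /or3P[] /eqP ->.
Qed.

(** The phase changes on arrival at position 2, and it is then the next letter that decides the new
    phase. *)
Lemma x_phase_enter : is_sigma1 (lett j) -> ~~ x_phase j -> x_phase j.+1 ->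
  ~~ is_sigma1 (lett j.+1).
Proof.
rewrite /x_phase odd_posS//; have := odd_pos_range (ltnW jn); rewrite !inE.
by case: (lett j) => // /or3P[] /eqP ->.
Qed.

Lemma y_phase_enter : ~~ is_sigma1 (lett j) -> x_phase j -> ~~ x_phase j.+1 ->
  is_sigma1 (lett j.+1).
Proof.
rewrite /x_phase odd_posS//; have := odd_pos_range (ltnW jn); rewrite !inE.
by case: (lett j) => // /or3P[] /eqP -> //=; rewrite ?negbK.
Qed.
End PhaseSteps.

Lemma x_phase0 : x_phase 0. Proof. by rewrite /x_phase odd_pos0. Qed.

(** * The indices of inertia of the form *)

Hypothesis last_letter : (0 < n)%N -> is_sigma1 (lett n.-1) = odd n.

(** A new x appears only at a [sigma1], and a new y only at a [sigma2V]; these sets index the ones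
    that appear in their own phase. *)
Definition x_steps : {set 'I_n} := [set j : 'I_n | is_sigma1 (lett j) && x_phase j.+1].
Definition y_steps : {set 'I_n} := [set j : 'I_n | ~~ is_sigma1 (lett j) && ~~ x_phase j.+1].

Let A := map_mx (fun m : int => m%:~R : algC)
  (seifert_matrix (plat_diagram L) + (seifert_matrix (plat_diagram L))^T).

(** Setting the x's of [x_steps] to 0 makes x vanish throughout the x phases. This removes all cross
    terms and leaves only negated squares of y's and of their differences. *)
Lemma plat_npos_le : (npos A <= #|x_steps|)%N.
Proof.
apply: (@seifert_npos_le _ (plat_diagram L) _
  (fun b : 'I_#|x_steps| => reg (enum_val b).+1 2) (fun=> reg 0 4)) => v vr vx.
have x0 j : (j <= n)%N -> x_phase j -> xdiff v j = 0.
  elim: j => [|j IH] jn; first by rewrite xdiff0.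
  have [aj|aj] := boolP (is_sigma1 (lett j)) => rj.
    have jI : Ordinal jn \in x_steps by rewrite inE aj.
    by have := vx (enum_rank_in jI (Ordinal jn)); rewrite enum_rankK_in// /xdiff => ->; rewrite subrr.
  rewrite xdiffS//; apply: IH; first exact: ltnW.
  by apply: contraTT rj => ?; exact: y_phase_keep.
have xr j : xdiff v j \is Num.real by rewrite realB.
have yr j : ydiff v j \is Num.real by rewrite realB.
rewrite -(pmulr_rle0 _ (@ltr0n algC 2)) seifert_form_plat.
rewrite big_seq; apply: sumr_le0 => j; rewrite mem_index_iota => /andP[_ jn].
rewrite /step_form; have [aj|aj] := boolP (is_sigma1 (lett j)); have [rj|rj] := boolP (x_phase j).
- by rewrite !x0 ?x_phase_keep// ?(ltnW jn)// subrr expr0n.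
- have [rj'|_] := boolP (x_phase j.+1); last by rewrite oppr_le0 real_exprn_even_ge0.
  by rewrite x0// mulr0 mul0r sub0r oppr_le0 real_exprn_even_ge0.
- by rewrite (x0 j) ?(ltnW jn)// mulr0 mul0r expr0n subr0; case: ifP.
- by rewrite oppr_le0 real_exprn_even_ge0// realB.
Qed.

Lemma plat_nneg_le : (nneg A <= #|y_steps|)%N.
Proof.
apply: (@seifert_nneg_le _ (plat_diagram L) _
  (fun b : 'I_#|y_steps| => reg (enum_val b).+1 3) (fun=> reg 0 1)) => v vr vy.
have y0 j : (j <= n)%N -> ~~ x_phase j -> ydiff v j = 0.
  elim: j => [|j IH] jn; first by rewrite x_phase0.
  have [aj|aj] := boolP (is_sigma1 (lett j)) => rj.
    rewrite ydiffS//; apply: IH; first exact: ltnW.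
    by apply: contra rj; exact: x_phase_keep.
  have jJ : Ordinal jn \in y_steps by rewrite inE aj.
  by have := vy (enum_rank_in jJ (Ordinal jn)); rewrite enum_rankK_in// /ydiff => ->; rewrite subrr.
have xr j : xdiff v j \is Num.real by rewrite realB.
have yr j : ydiff v j \is Num.real by rewrite realB.
rewrite -(pmulr_rge0 _ (@ltr0n algC 2)) seifert_form_plat.
rewrite big_seq; apply: sumr_ge0 => j; rewrite mem_index_iota => /andP[_ jn].
rewrite /step_form; have [aj|aj] := boolP (is_sigma1 (lett j)); have [rj|rj] := boolP (x_phase j).
- by rewrite real_exprn_even_ge0// realB.
- by rewrite (y0 j) ?(ltnW jn)// mulr0 expr0n oppr0 addr0; case: ifP.
- have [_|rj'] := boolP (x_phase j.+1); first by rewrite real_exprn_even_ge0.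
  by rewrite y0// mulr0 subr0 real_exprn_even_ge0.
- by rewrite !y0 ?y_phase_keep// ?(ltnW jn)// subrr expr0n oppr0.
Qed.


Definition cell_fun (X Y : nat -> algC) (c : cell L) : algC :=
  if c.2 == 2 :> nat then X c.1 else if c.2 == 3 :> nat then Y c.1 else 0.

(** The hypotheses say that the function on cells is compatible with the gluing, so that it descends
    to the regions. *)
Lemma cell_fun_region_at X Y j l : X 0%N = 0 ->
  (forall i, (i < n)%N -> ~~ is_sigma1 (lett i) -> X i.+1 = X i) ->
  (forall i, (i < n)%N -> is_sigma1 (lett i) -> Y i.+1 = Y i) ->
  (if odd n then X n = 0 else Y n = 0) ->
  (j <= n)%N -> (l < 5)%N ->
  cell_fun X Y (reg j l) = if l == 2 then X j else if l == 3 then Y j else 0.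
Proof.
move=> X0 XS YS XYn jn l5; rewrite /region_at glued_invariant_root.
  by rewrite /cell_fun /= !inordK.
move=> [c l1] [d l2]; rewrite /cell_adj /cell_fun /=.
case/or3P => /and3P[].
- move=> /eqP E /eqP <-; have cn : (c < n)%N by rewrite -ltnS -E.
  rewrite E; have := (XS c cn, YS c cn); case: (lett c) => /= -[XSc YSc] l1g.
    by rewrite YSc// eq_sym (negbTE l1g).
  by rewrite XSc// [_ == 3%N]eq_sym (negbTE l1g).
- move=> /eqP -> /eqP ->; rewrite /joined_left X0.
  by case: l1 l2 => [[|[|[|[|[|l1]]]]] ?] [[|[|[|[|[|l2]]]]] ?].
- move=> /eqP -> /eqP ->; rewrite /joined_right; move: XYn.
  case: (odd n) => ->.
    by case: l1 l2 => [[|[|[|[|[|l1]]]]] ?] [[|[|[|[|[|l2]]]]] ?].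
  by case: l1 l2 => [[|[|[|[|[|l1]]]]] ?] [[|[|[|[|[|l2]]]]] ?].
Qed.

Fixpoint last_step_of (s : bool) (j : nat) : option nat :=
  if j is i.+1 then if is_sigma1 (lett i) == s then Some i else last_step_of s i
  else None.

Section Coordinates.
Variables (s : bool) (S : {set 'I_n}).
Hypothesis S_inner : forall i, i \in S -> (i.+1 < n)%N /\ is_sigma1 (lett i) = s.

(** This is 1 from just after the step of index [a] until the next letter of kind [s], and 0
    elsewhere. It is constant across letters of the other kind, as the gluing requires. *)
Definition coord (a : 'I_#|S|) (j : nat) : algC :=
  (last_step_of s j == Some (enum_val a : nat))%:R.

Lemma coordS a j : is_sigma1 (lett j) != s -> coord a j.+1 = coord a j.
Proof. by rewrite /coord /= => /negbTE ->. Qed.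

Lemma coord_end a : (0 < n)%N -> is_sigma1 (lett n.-1) = s -> coord a n = 0.
Proof.
move=> n0 ls; have E : last_step_of s n.-1.+1 = Some n.-1 by rewrite /= ls eqxx.
rewrite prednK// in E; rewrite /coord E.
case: eqP => // -[H]; have [] := S_inner (enum_valP a).
by rewrite -H prednK// ltnn.
Qed.

Lemma coord_step (a b : 'I_#|S|) : coord a (enum_val b).+1 = (a == b)%:R.
Proof.
rewrite /coord /=; have [_ ->] := S_inner (enum_valP b).
rewrite eqxx; congr (_%:R); rewrite (inj_eq Some_inj).
by rewrite (inj_eq val_inj) (inj_eq enum_val_inj) eq_sym.
Qed.
End Coordinates.

Definition inner (S : {set 'I_n}) : {set 'I_n} := [set i in S | (i.+1 < n)%N].

(* The subspace y = 0 on which the form is positive definite.  The last step is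
   left out because x vanishes at the right end if the last letter is sigma1. *)
Lemma plat_npos_ge : (#|inner x_steps| <= npos A)%N.
Proof.
have S_inner i : i \in inner x_steps -> (i.+1 < n)%N /\ is_sigma1 (lett i) = true.
  by rewrite !inE => /andP[/andP[-> _] ->].
pose U a := cell_fun (@coord true (inner x_steps) a) (fun=> 0).
have Ureg a j l : (j <= n)%N -> (l < 5)%N -> U a (reg j l) =
    if l == 2 then coord true a j else 0.
  move=> jn l5; rewrite /U cell_fun_region_at//; first by case: (l == 3).
    by move=> i _ li; rewrite coordS// eqb_id.
  case: ifP => // on; apply: (coord_end S_inner).
    by case: (n) on.
  by rewrite last_letter//; case: (n) on.
apply: (seifert_npos_ge (plat_smoothing_invariant) (U := U)) => [a f|u ur [a0 ua0]].
  by rewrite /U /cell_fun; case: ifP => _; [exact: realn|case: ifP].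
set W := fun f => _.
have Wy j : (j <= n)%N -> ydiff W j = 0.
  by move=> jn; rewrite /ydiff /W !big1 ?subrr// => a _; rewrite Ureg// mulr0.
have WX j : (j <= n)%N -> xdiff W j = \sum_a u a * coord true a j.
  move=> jn; rewrite /xdiff [X in _ - X]big1 => [|a _]; last by rewrite Ureg// mulr0.
  by rewrite subr0; apply: eq_bigr => a _; rewrite Ureg.
have Wr j : (j <= n)%N -> xdiff W j \is Num.real.
  by move=> jn; rewrite WX// sum_real// => a _; rewrite realM// realn.
have Wa (a : 'I_#|inner x_steps|) : xdiff W (enum_val a).+1 = u a.
  rewrite WX// (bigD1 a)//= (coord_step S_inner) eqxx mulr1 big1 ?addr0// => b ba.
  by rewrite (coord_step S_inner) (negbTE ba) mulr0.
(* With y = 0 these nonnegative terms are all that is left of the form. *)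
pose t j : algC := if is_sigma1 (lett j)
  then if x_phase j then (xdiff W j.+1 - xdiff W j) ^+ 2 else 0
  else if x_phase j then xdiff W j ^+ 2 else 0.
have t0 (j : 'I_n) : 0 <= t j.
  rewrite /t; case: ifP => _; case: ifP => // _; rewrite real_exprn_even_ge0//.
    by rewrite realB// Wr// ltnW.
  by rewrite Wr// ltnW.
have E : 2 * seifert_form (plat_diagram L) W = \sum_(j < n) t j.
  rewrite seifert_form_plat big_mkord; apply: eq_bigr => j _.
  rewrite /step_form /t !Wy ?(ltnW (ltn_ord j))//.
  by case: (is_sigma1 _); case: (x_phase j); case: (x_phase j.+1); ring.
rewrite -(pmulr_rgt0 _ (ltr0n algC 2)) E lt_def sumr_ge0 ?andbT; last by move=> j _; exact: t0.
apply/negP => /eqP E0; have tz := psumr_eq0P (fun j _ => t0 j) E0.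
(* If all terms vanish, x is constant within an x phase; at its entrance the next letter is a
   [sigma2V], whose term is the square of x. *)
have x0 j : (j < n)%N -> x_phase j -> xdiff W j = 0.
  elim: j => [|j IH] jn rj; first by rewrite xdiff0.
  have jn' := ltnW jn.
  have [aj|aj] := boolP (is_sigma1 (lett j)); last first.
    rewrite xdiffS//; apply: IH => //.
    by apply: contraTT rj => ?; exact: y_phase_keep.
  have [rj'|rj'] := boolP (x_phase j).
    have := tz (Ordinal jn') isT; rewrite /t /= aj rj' => /eqP.
    by rewrite sqrf_eq0 subr_eq0 => /eqP ->; exact: IH.
  have := tz (Ordinal jn) isT; rewrite /t /= rj.
  by rewrite (negbTE (x_phase_enter jn' aj rj' rj)) => /eqP; rewrite sqrf_eq0 => /eqP.
move: ua0; rewrite -Wa x0 ?eqxx//.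
  by have := enum_valP a0; rewrite inE => /andP[].
by have := enum_valP a0; rewrite !inE => /andP[/andP[]].
Qed.

(** The same with x = 0; here y vanishes at the right end if the last letter is [sigma2V]. *)
Lemma plat_nneg_ge : (#|inner y_steps| <= nneg A)%N.
Proof.
have S_inner i : i \in inner y_steps -> (i.+1 < n)%N /\ is_sigma1 (lett i) = false.
  by rewrite !inE => /andP[/andP[/negbTE -> _] ->].
pose U a := cell_fun (fun=> 0) (@coord false (inner y_steps) a).
have Ureg a j l : (j <= n)%N -> (l < 5)%N -> U a (reg j l) =
    if l == 3 then coord false a j else 0.
  move=> jn l5; rewrite /U cell_fun_region_at//.
  - by case: (l == 2) / eqP => // ->.
  - by move=> i _ li; rewrite coordS// li.
  case: ifP => // on.
  have [n0|n0] := posnP n; first by rewrite [X in coord _ _ X]n0.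
  by apply: (coord_end S_inner); rewrite ?last_letter.
apply: (seifert_nneg_ge (plat_smoothing_invariant) (U := U)) => [a f|u ur [a0 ua0]].
  by rewrite /U /cell_fun; case: ifP => _ //; case: ifP => // _; exact: realn.
set W := fun f => _.
have Wx j : (j <= n)%N -> xdiff W j = 0.
  by move=> jn; rewrite /xdiff /W !big1 ?subrr// => a _; rewrite Ureg// mulr0.
have WY j : (j <= n)%N -> ydiff W j = \sum_a u a * coord false a j.
  move=> jn; rewrite /ydiff [X in _ - X]big1 => [|a _]; last by rewrite Ureg// mulr0.
  by rewrite subr0; apply: eq_bigr => a _; rewrite Ureg.
have Wr j : (j <= n)%N -> ydiff W j \is Num.real.
  by move=> jn; rewrite WY// sum_real// => a _; rewrite realM// realn.
have Wa (a : 'I_#|inner y_steps|) : ydiff W (enum_val a).+1 = u a.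
  rewrite WY// (bigD1 a)//= (coord_step S_inner) eqxx mulr1 big1 ?addr0// => b ba.
  by rewrite (coord_step S_inner) (negbTE ba) mulr0.
pose t j : algC := if is_sigma1 (lett j)
  then if x_phase j then 0 else ydiff W j ^+ 2
  else if x_phase j then 0 else (ydiff W j.+1 - ydiff W j) ^+ 2.
have t0 (j : 'I_n) : 0 <= t j.
  rewrite /t; case: ifP => _; case: ifP => // _; rewrite real_exprn_even_ge0//.
    by rewrite Wr// ltnW.
  by rewrite realB// Wr// ltnW.
have E : 2 * seifert_form (plat_diagram L) W = - \sum_(j < n) t j.
  rewrite seifert_form_plat big_mkord -sumrN; apply: eq_bigr => j _.
  rewrite /step_form /t !Wx ?(ltnW (ltn_ord j))//.
  by case: (is_sigma1 _); case: (x_phase j); case: (x_phase j.+1); ring.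
rewrite -(pmulr_rlt0 _ (@ltr0n algC 2)) E oppr_lt0 lt_def sumr_ge0 ?andbT; last by move=> j _; exact: t0.
apply/negP => /eqP E0; have tz := psumr_eq0P (fun j _ => t0 j) E0.
have y0 j : (j < n)%N -> ~~ x_phase j -> ydiff W j = 0.
  elim: j => [|j IH] jn rj; first by rewrite x_phase0 in rj.
  have jn' := ltnW jn.
  have [aj|aj] := boolP (is_sigma1 (lett j)).
    rewrite ydiffS//; apply: IH => //.
    by apply: contra rj; exact: x_phase_keep.
  have [rj'|rj'] := boolP (x_phase j); last first.
    have := tz (Ordinal jn') isT; rewrite /t /= (negbTE aj) (negbTE rj') => /eqP.
    by rewrite sqrf_eq0 subr_eq0 => /eqP ->; exact: IH.
  have := tz (Ordinal jn) isT; rewrite /t /= (negbTE rj).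
  by rewrite (y_phase_enter jn' aj rj' rj) => /eqP; rewrite sqrf_eq0 => /eqP.
move: ua0; rewrite -Wa y0 ?eqxx//.
  by have := enum_valP a0; rewrite inE => /andP[].
by have := enum_valP a0; rewrite !inE => /andP[/andP[]].
Qed.


Let card_inner (S : {set 'I_n}) : (#|S| <= #|inner S|.+1)%N.
Proof.
pose E := [set i : 'I_n | ~~ (i.+1 < n)%N].
have E1 : (#|E| <= 1)%N.
  apply/card_le1_eqP => i k; rewrite !inE => iE kE; apply: val_inj => /=.
  by have := ltn_ord i; have := ltn_ord k; lia.
apply: (@leq_trans #|inner S :|: E|).
  by apply: subset_leq_card; apply/subsetP => i; rewrite !inE => ->; case: (_ < n)%N.
by apply: (leq_trans (leq_card_setU _ _)); rewrite -addn1 leq_add2l.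
Qed.

Let cards_sum (S : {set 'I_n}) : #|S|%:Z = \sum_(j < n) (j \in S)%:Z.
Proof.
rewrite -sum1_card big_mkcond /= -natz natr_sum; apply: eq_bigr => j _.
by case: (j \in S).
Qed.

(* A letter counts as a step up or down of the odd strand; one that leaves it at
   position 3 counts as a step up, one that leaves it at 1 as a step down. *)
Definition steps_up j : bool := is_sigma1 (lett j) (+) (odd_pos j == 2)%N.

(** Each letter contributes to the left side its sign plus the increment of [x_phase - odd_pos]. The
    increments telescope, and the initial value is 1 - 3 = -2. *)
Lemma card_steps : #|x_steps|%:Z - #|y_steps|%:Z =
  \sum_(j < n) (if steps_up j then 1 else -1 : int) + (x_phase n)%:Z - (odd_pos n)%:Z + 2.
Proof.
pose psi j : int := (x_phase j)%:Z - (odd_pos j)%:Z.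
have psi0 : psi 0%N = -2 by rewrite /psi x_phase0 odd_pos0.
rewrite -addrA -addrA (_ : _ + (_ + 2) = psi n - psi 0%N); last by rewrite psi0 /psi; ring.
rewrite -(telescope_sumr psi (leq0n n)) big_mkord -big_split /= !cards_sum -sumrB.
apply: eq_bigr => j _; rewrite !inE /psi /steps_up /x_phase odd_posS//.
have := odd_pos_range (ltnW (ltn_ord j)); rewrite !inE.
by case: (lett j) => /or3P[] /eqP -> /=; case: (is_sigma1 (lett j.+1)).
Qed.

Theorem plat_signature_walk :
  `|diagram_signature (plat_diagram L) - \sum_(j < n) (if steps_up j then 1 else -1)| <= 2 :> int.
Proof.
have -> : diagram_signature (plat_diagram L) = (npos A)%:Z - (nneg A)%:Z by [].
have xn : (x_phase n <= 1)%N by case: (x_phase n).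
have pn : (1 <= odd_pos n <= 3)%N && (odd_pos n - 2 <= x_phase n)%N
    && (x_phase n <= odd_pos n - 2)%N.
  have := odd_pos_range (leqnn n); rewrite !inE /x_phase.
  (* Past the end the default letter is [sigma1], so the final phase is an x phase only at position
     3. *)
  by rewrite nth_default// => /or3P[] /eqP ->.
have := card_steps; have := plat_npos_le; have := plat_npos_ge.
have := plat_nneg_le; have := plat_nneg_ge.
have := card_inner x_steps; have := card_inner y_steps.
move: xn pn; move: (odd_pos n) (nat_of_bool (x_phase n)) => p r.
set s := \sum_(_ < _) _; lia.
Qed.
End Plat.

(** * Words and clamped walks *)

Fixpoint alternate (b : bool) (e : seq nat) : seq (bool * nat) :=
  if e is m :: e' then (b, m) :: alternate (~~ b) e' else [::].

Definition unruns (r : seq (bool * nat)) : seq bool :=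
  flatten [seq nseq p.2 p.1 | p <- r].

Lemma runs_alternate w : runs w = alternate (head false w) (run_lengths w).
Proof.
rewrite /run_lengths; elim: w => // x [|y w] // IH.
have -> : runs (x :: y :: w) = if runs (y :: w) is (z, m) :: r
  then if x == z then (x, m.+1) :: r else (x, 1%N) :: (z, m) :: r else [:: (x, 1%N)] by [].
move: IH; case: (runs (y :: w)) => [|[z m] r] // [-> rE]; rewrite [head _ _]/=.
case: (x =P y) => [->|/eqP xy] /=; first by rewrite -rE.
have -> : ~~ x = y by move: xy; clear; case: x; case: y.
by rewrite -rE.
Qed.

Lemma unrunsK w : unruns (runs w) = w.
Proof.
elim: w => //= x w IH; case: (runs w) IH => [|[y m] r] /= IH.
  by rewrite -IH.
by case: eqP => [->|_]; rewrite /unruns /= -IH.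
Qed.

Lemma alternate_runs b e : all (fun m => 0 < m)%N e -> runs (unruns (alternate b e)) = alternate b e.
Proof.
elim: e b => //= m e IH b /andP[m0 /IH{}IH]; rewrite /unruns /= -/(unruns _).
elim: m m0 => // m IHm _.
case: m IHm => [_|m IHm] /=.
  rewrite IH; case: e IH => //= k e IH; rewrite eq_sym.
  by case: b IH.
have := IHm isT => /= ->; by rewrite eqxx.
Qed.

Lemma size_alternate b e : size (alternate b e) = size e.
Proof. by elim: e b => //= m e IH b; rewrite IH. Qed.

Lemma alternate_rcons b e m :
  alternate b (rcons e m) = rcons (alternate b e) (b (+) odd (size e), m).
Proof.
by elim: e b => /= [|k e IH] b; rewrite ?addbF// IH; congr (_ :: rcons _ (_, _)); case: b; case: (odd _).
Qed.

Definition one_or_two (m : nat) : bool := (m == 1)%N || (m == 2)%N.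

Lemma run_lengths_alternate w e : runs w = alternate true e -> run_lengths w = e.
Proof.
by move=> rw; rewrite /run_lengths rw; elim: e true {rw} => //= m e IH b; rewrite IH.
Qed.

Definition letters b e : seq letter := [seq run_letter p | p <- alternate b e].

Definition to_letter (s : bool) : letter := if s then sigma1 else sigma2V.

Lemma is_sigma1K : cancel is_sigma1 to_letter. Proof. by case. Qed.
Lemma to_letterK : cancel to_letter is_sigma1. Proof. by case. Qed.

Lemma is_sigma1_run_letter b m : one_or_two m -> is_sigma1 (run_letter (b, m)) = b (+) (m == 2)%N.
Proof. by case: b => /orP[] /eqP ->. Qed.

Fixpoint unletters (b : bool) (L : seq letter) : seq nat :=
  if L is a :: L' then (if is_sigma1 a == b then 1 else 2) :: unletters (~~ b) L'
  else [::].

Lemma lettersK b e : all one_or_two e -> unletters b (letters b e) = e.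
Proof.
elim: e b => //= m e IH b /andP[m12 /IH {}IH].
rewrite (is_sigma1_run_letter b m12) -/(letters _ _) IH; congr (_ :: _).
by case: b => //; case/orP: m12 => /eqP ->.
Qed.

Lemma unlettersK b L : letters b (unletters b L) = L.
Proof.
elim: L b => //= a L IH b; rewrite /letters /= -/(letters _ _) IH; congr (_ :: _).
by case: a; case: b.
Qed.

Lemma unletters_one_or_two b L : all one_or_two (unletters b L).
Proof. by elim: L b => //= a L IH b; rewrite IH andbT; case: ifP. Qed.

Lemma size_letters b e : size (letters b e) = size e.
Proof. by rewrite size_map size_alternate. Qed.

Lemma size_unletters b L : size (unletters b L) = size L.
Proof. by elim: L b => //= a L IH b; rewrite IH. Qed.

(** The signs [steps_up] for a strand starting at [p]. As the position is known at each step, the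
    sign determines the letter, which gives the inverse [undeltas]. *)
Fixpoint deltas (p : nat) (L : seq letter) : seq bool :=
  if L is a :: L' then is_sigma1 a (+) (p == 2)%N :: deltas (exchange a p) L' else [::].

Fixpoint undeltas (p : nat) (d : seq bool) : seq letter :=
  if d is x :: d' then
    let a := to_letter (x (+) (p == 2)%N) in a :: undeltas (exchange a p) d'
  else [::].

Lemma deltasK p L : undeltas p (deltas p L) = L.
Proof. by elim: L p => //= a L IH p; rewrite addbK is_sigma1K IH. Qed.

Lemma undeltasK p d : deltas p (undeltas p d) = d.
Proof. by elim: d p => //= x d IH p; rewrite to_letterK addbK IH. Qed.

Lemma size_deltas p L : size (deltas p L) = size L.
Proof. by elim: L p => //= a L IH p; rewrite IH. Qed.

Lemma size_undeltas p d : size (undeltas p d) = size d.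
Proof. by elim: d p => //= a L IH p; rewrite IH. Qed.

Definition track (p : nat) (L : seq letter) : nat := foldl (fun p a => exchange a p) p L.

Lemma deltas_cat p L1 L2 : deltas p (L1 ++ L2) = deltas p L1 ++ deltas (track p L1) L2.
Proof. by elim: L1 p => //= a L1 IH p; rewrite IH. Qed.

Definition clamp_step (p : nat) (x : bool) : nat :=
  if x then (if p == 1 then 2 else 3)%N else (if p == 3 then 2 else 1)%N.

Lemma track_range p L : p \in [:: 1; 2; 3]%N -> track p L \in [:: 1; 2; 3]%N.
Proof.
elim: L p => //= a L IH p p3; apply: IH.
by move: p3; rewrite !inE; case: a => /or3P[] /eqP ->.
Qed.

Lemma track_clamp p L : p \in [:: 1; 2; 3]%N ->
  track p L = foldl clamp_step p (deltas p L).
Proof.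
elim: L p => //= a L IH p p3; rewrite IH.
  by congr foldl; move: p3; rewrite !inE; case: a => /or3P[] /eqP ->.
by move: p3; rewrite !inE; case: a => /or3P[] /eqP ->.
Qed.

(** [exchange] with a given letter is an involution. *)
Lemma left_end_track L p : left_end L (size L) (track p L) = p.
Proof.
rewrite /left_end take_size; elim/last_ind: L => //= L a IH.
rewrite foldr_rcons /track foldl_rcons -/(track _ _) -[RHS]IH; congr foldr.
by rewrite /exchange; case: a => /=; do !case: eqP => //; lia.
Qed.

Section Mod3.
Local Open Scope ring_scope.

(* Modulo 3 the letter of a run of length e acts on positions by
   p -> -p -e + 1 (runs of +) or p -> -p + e + 1 (runs of -). *)
Lemma track_mod b e p : p \in [:: 1; 2; 3]%N -> all one_or_two e ->
  exists k : int,
    (let q := (track p (letters b e))%:Z in if b (+) odd (size e) then - q else q)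
    = (if b then - p%:Z else p%:Z) - (sumn e)%:Z
      + (if odd (size e) then if b then 1 else -1 else 0) + 3 * k.
Proof.
elim: e b p => [|m e IH] b p p3.
  by exists 0; rewrite /= addbF; case: b; ring.
move=> /= /andP[m12 e12]; rewrite /letters /= -/(letters _ _).
set p' := exchange (run_letter (b, m)) p.
have p3' : p' \in [:: 1; 2; 3]%N by rewrite (@track_range p [:: run_letter (b, m)]).
have [k] := IH (~~ b) p' p3' e12.
have [j] : exists j : int, (if ~~ b then - p'%:Z else p'%:Z)
    = (if b then - p%:Z else p%:Z) - m%:Z + (if b then 1 else -1) + 3 * j.
  rewrite /p'; clear p' p3' k; move: p3 m12; rewrite !inE /one_or_two.
  case: b => /or3P[] /eqP -> /orP[] /eqP -> /=; lazymatch goal with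
    |- exists j : int, ?l = ?r + 3 * j => by exists (divz (l - r) 3) end.
move=> -> E; exists (k + j); move: E; rewrite addNb addbN.
move=> /= ->; clear; case: b; case: (odd _) => /=; lia.
Qed.

Lemma track_knot e p : p \in [:: 1; 2; 3]%N -> all one_or_two e ->
  (sumn e %% 3 = 1)%N ->
  track p (letters true e) =
    if odd (size e) then (if p == 3 then 3 else 3 - p)%N else (if p == 3 then 1 else p.+1)%N.
Proof.
move=> p3 e12 e1; have [k] := track_mod true p3 e12.
have := track_range (letters true e) p3; move: p3; rewrite !inE.
move: (track _ _) => q; case: (odd _) => /=; do !case: eqP => //=; lia.
Qed.

(** The first and the last run of a word add 2 to the sum, so the middle runs, which begin with a
    run of -, must have sum 2 modulo 3. The positions 1, 2, 3 are distinct modulo 3, so the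
    congruence is a condition on the final position. *)
Lemma track_middle e : all one_or_two e ->
  (sumn e %% 3 == 2)%N = (track 3 (letters false e) == if odd (size e) then 3 else 1)%N.
Proof.
move=> e12; have [k] := track_mod false (isT : 3 \in [:: 1; 2; 3]%N) e12.
have := track_range (letters false e) (isT : 3 \in [:: 1; 2; 3]%N); rewrite !inE.
move: (track _ _) => q; case: (odd _) => /=; do !case: eqP => //=; lia.
Qed.
End Mod3.

Lemma track0 L : track 0 L = 0.
Proof. by elim: L => //= a L IH; case: a. Qed.

(** * The words of T(c) and their walks *)

Section TWord.
Variables (n : nat) (w : seq bool).
Hypothesis wT : in_T n.+2 w.
Local Notation e := (run_lengths w).
Local Notation L := (braid_word w).

Lemma T_run_lengths : exists2 m, e = 1 :: rcons m 1 &
  [/\ size m = n, all one_or_two m & sumn m %% 3 = 2].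
Proof.
case/and5P: (wT) => /eqP sz _ e12 /eqP hd /andP[/eqP lst /eqP e3].
case: e sz e12 hd lst e3 => //= x; case/lastP => // m y.
rewrite size_rcons last_rcons => -[] sz /= /andP[_]; rewrite all_rcons => /andP[_ m12] -> ->.
rewrite sumn_rcons => e3; exists m => //; split=> //.
by move: e3; rewrite add1n addn1; lia.
Qed.

Lemma T_braid_word : L = letters true e.
Proof.
rewrite /braid_word runs_alternate.
by case/and5P: (wT) => _ ->.
Qed.

Lemma T_run_lengths_one_or_two : all one_or_two e.
Proof. by case/and5P: (wT). Qed.

Lemma T_size : size L = n.+2.
Proof. by rewrite T_braid_word size_letters; case/and5P: (wT) => /eqP. Qed.

(** The congruence makes the permutation of the strands depend on the parity of [n] alone; this
    fixes the orientation in [T_coherent]. *)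
Lemma T_track p : p \in [:: 1; 2; 3] -> track p L =
    if odd n then (if p == 3 then 3 else 3 - p) else (if p == 3 then 1 else p.+1).
Proof.
move=> p3; rewrite T_braid_word track_knot ?T_run_lengths_one_or_two//.
  by case/and5P: (wT) => /eqP -> /=; rewrite negbK.
by case/and5P: (wT) => _ _ _ _ /andP[_ /eqP].
Qed.

Lemma T_coherent b : coherent L b = ~~ b.
Proof.
have lt p := left_end_track L p.
have t1 := T_track (isT : 1 \in [:: 1; 2; 3]).
have t2 := T_track (isT : 2 \in [:: 1; 2; 3]).
have t3 := T_track (isT : 3 \in [:: 1; 2; 3]).
rewrite /coherent /rightward T_size /= negbK -T_size.
have := (lt 0, lt 1, lt 2, lt 3); rewrite track0 t1 t2 t3.
by case: (odd n) => /= -[[[-> ->] ->] ->]; case: b.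
Qed.

Lemma T_letters : exists m,
  [/\ size m = n, all one_or_two m, sumn m %% 3 = 2, e = 1 :: rcons m 1
    & L = sigma1 :: rcons (letters false m) (to_letter (odd n))].
Proof.
have [m em [sm m12 m3]] := T_run_lengths; exists m; split=> //.
rewrite T_braid_word em /letters /= alternate_rcons map_rcons sm addFb.
by case: (odd n).
Qed.

Lemma T_last_letter : is_sigma1 (nth sigma1 L (size L).-1) = odd (size L).
Proof.
rewrite T_size /=; have [m [sm _ _ _ ->]] := T_letters.
by rewrite /= nth_rcons size_letters sm ltnn eqxx to_letterK negbK.
Qed.

End TWord.

Definition walk_sum (d : seq bool) : int := (\sum_(x <- d) (if x then 1 else -1))%R.

Lemma walk_sum_deltas p L :
  (\sum_(j < size L)
     (if is_sigma1 (nth sigma1 L j) (+) (track p (take j L) == 2%N) then 1 else -1))%R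
  = walk_sum (deltas p L).
Proof.
rewrite /walk_sum; elim: L p => [|a L IH] p /=; first by rewrite big_nil big_ord0.
by rewrite big_ord_recl big_cons /= -IH.
Qed.

(* The first and the last letter of a word of T(n + 2) are forced. *)
Definition walk_code n (w : seq bool) : n.-tuple bool :=
  [tuple nth false (deltas 3 (braid_word w)) i.+1 | i < n].

Definition bridge_walks n : {set n.-tuple bool} :=
  [set d : n.-tuple bool | foldl clamp_step 3 d == if odd n then 3 else 1].

(** The forced first letter [sigma1] leaves the odd strand at position 3, so the middle walk starts
    there as well. *)
Lemma T_code n w m x : size m = n -> braid_word w = sigma1 :: rcons (letters false m) x ->
  walk_code n w = deltas 3 (letters false m) :> seq bool.
Proof.
move=> sm Lw; apply: (@eq_from_nth _ false).
  by rewrite size_tuple size_deltas size_letters.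
move=> i; rewrite size_tuple => i_n.
rewrite -(tnth_nth _ _ (Ordinal i_n)) tnth_mktuple Lw -cats1 /= deltas_cat nth_cat.
by rewrite size_deltas size_letters sm i_n.
Qed.

Lemma T_code_walk n w : in_T n.+2 w -> walk_code n w \in bridge_walks n.
Proof.
move=> /T_letters [m [sm m12 m3 _ Lw]].
rewrite inE (T_code sm Lw) -track_clamp// -sm -track_middle//.
by rewrite m3.
Qed.

Lemma walk_code_inj n w w' : in_T n.+2 w -> in_T n.+2 w' -> walk_code n w = walk_code n w' -> w = w'.
Proof.
move=> wT w'T cww.
have [m [sm m12 _ em Lw]] := T_letters wT.
have [m' [sm' m12' _ em' Lw']] := T_letters w'T.
have E : deltas 3 (letters false m) = deltas 3 (letters false m').
  by rewrite -(T_code sm Lw) cww (T_code sm' Lw').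
have mm : m = m' by rewrite -(lettersK false m12) -(deltasK 3 (letters _ _)) E deltasK lettersK.
rewrite -[w]unrunsK -[w']unrunsK !runs_alternate em em' mm.
by case/and5P: wT => _ -> _ _ _; case/and5P: w'T => _ -> _ _ _.
Qed.

Lemma size_unruns b e : size (unruns (alternate b e)) = sumn e.
Proof.
elim: e b => //= m e IH b; rewrite /unruns /= -/(unruns _).
by rewrite size_cat size_nseq IH.
Qed.

Lemma T_words_of_run_lengths c e : size e = c -> all one_or_two e -> head 0 e = 1 ->
  last 0 e = 1 -> sumn e %% 3 = 1 ->
  exists2 w, w \in T_words c & run_lengths w = e.
Proof.
move=> sz e12 hd lst e3; pose w := unruns (alternate true e).
have rw : runs w = alternate true e.
  by rewrite alternate_runs//; apply: sub_all e12 => k /orP[] /eqP ->.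
have rl : run_lengths w = e := run_lengths_alternate rw.
have sw : size w <= c.*2.
  rewrite size_unruns -sz; elim: {+}e e12 => //= k e' IH /andP[k12 /IH].
  by move: k12 => /orP[] /eqP ->; lia.
exists (Bseq sw) => //; rewrite inE /in_T rl sz hd lst e3 !eqxx /= e12 andbT.
by rewrite /w; case: (e) hd => [|k e'] //= ->.
Qed.

Lemma walk_code_surj n (d : n.-tuple bool) : d \in bridge_walks n ->
  exists2 w, w \in T_words n.+2 & walk_code n w = d.
Proof.
rewrite inE => /eqP dw.
pose m := unletters false (undeltas 3 d).
have m12 : all one_or_two m := unletters_one_or_two _ _.
have sm : size m = n by rewrite size_unletters size_undeltas size_tuple.
have Lm : letters false m = undeltas 3 d by rewrite unlettersK.
have m3 : sumn m %% 3 = 2.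
  by apply/eqP; rewrite track_middle// Lm track_clamp// undeltasK sm dw.
have [w wT rl] : exists2 w, w \in T_words n.+2 & run_lengths w = 1 :: rcons m 1.
  apply: T_words_of_run_lengths; rewrite //= ?size_rcons ?sm ?all_rcons ?last_rcons//.
  by rewrite sumn_rcons add1n addn1; lia.
exists w => //; apply: val_inj => /=; rewrite inE in wT.
have [m' [sm' _ _ em' Lw]] := T_letters wT.
have mm : m' = m by move: em'; rewrite rl => -[] /rcons_inj [].
by rewrite -/(tval (walk_code n w)) (T_code sm' Lw) mm Lm undeltasK.
Qed.

Lemma card_T_code n (Q : pred (n.-tuple bool)) :
  #|[set w in T_words n.+2 | Q (walk_code n w)]| = #|[set d in bridge_walks n | Q d]|.
Proof.
rewrite -(@card_in_imset _ _ (fun w : (n.+2.*2).-bseq bool => walk_code n w)); last first.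
  by move=> w w'; rewrite !inE => /andP[wT _] /andP[w'T _] /(walk_code_inj wT w'T) /val_inj.
apply: eq_card => d; rewrite inE; apply/imsetP/andP => [[w]|[dw Qd]].
  by rewrite !inE => /andP[wT Qw] ->; split=> //; have := T_code_walk wT; rewrite inE.
by have [w wT wd] := walk_code_surj dw; exists w; rewrite // inE wT /= wd.
Qed.

(** * Orbits under reversal and palindromes *)

Lemma T_words_inj c : {in T_words c &, injective (fun w : (c.*2).-bseq bool => run_lengths w)}.
Proof.
move=> w w'; rewrite !inE => wT w'T E; apply: val_inj => /=.
rewrite -[val w]unrunsK -[val w']unrunsK !runs_alternate E.
by case/and5P: wT => _ -> _ _ _; case/and5P: w'T => _ -> _ _ _.
Qed.

Lemma T_words_rev c (w : (c.*2).-bseq bool) : w \in T_words c ->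
  exists2 w', w' \in T_words c & run_lengths w' = rev (run_lengths w).
Proof.
rewrite inE => /and5P[/eqP sz _ e12 /eqP hd /andP[/eqP lst /eqP e3]].
apply: T_words_of_run_lengths; rewrite ?size_rev ?all_rev ?sumn_rev//.
  by rewrite -lst; case/lastP: (run_lengths w) => // s x; rewrite rev_rcons last_rcons.
by rewrite -hd; case: (run_lengths w) => // x s; rewrite rev_cons last_rcons.
Qed.

(** In every orbit the number of words plus the number of palindromes is 2. *)
Lemma card_K_knots c : (#|K_knots c|.*2 = #|T_words c| + #|Tp_words c|).
Proof.
pose e (w : (c.*2).-bseq bool) := run_lengths w.
pose R (w v : (c.*2).-bseq bool) := (e v == e w) || (e v == rev (e w)).
have KE : K_knots c = equivalence_partition R (T_words c) by [].
have Kpart : partition (K_knots c) (T_words c).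
  rewrite KE; apply: equivalence_partitionP => x y z _ _ _; rewrite /R; split; first by rewrite eqxx.
  by case/orP => /eqP ->; rewrite ?revK// orbC.
have sumK (F : (c.*2).-bseq bool -> nat) :
    \sum_(O in K_knots c) \sum_(w in O) F w = \sum_(w in T_words c) F w.
  by rewrite (set_partition_big _ Kpart).
rewrite -[#|T_words c|]sum1_card -(sumK (fun=> 1)).
have -> : #|Tp_words c| = \sum_(w in T_words c) (rev (e w) == e w).
  rewrite -sum1_card big_mkcond [RHS]big_mkcond /=; apply: eq_bigr => w _.
  by rewrite !inE; case: (in_T _ _); case: eqP.
rewrite -sumK -big_split /= -muln2 -sum1_card big_distrl /=.
apply: eq_bigr => O /imsetP[w wT ->].
have [w' w'T ew'] := T_words_rev wT.
have OE : rev_orbit w = [set w; w'].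
  apply/setP => v; rewrite !inE; apply/andP/orP => [[vT /orP[] /eqP ev]|[] /eqP ->].
  - by left; apply/eqP/T_words_inj => //; rewrite inE.
  - by right; apply/eqP/T_words_inj; rewrite // ?ew' ?inE.
  - by move: wT; rewrite inE eqxx.
  - by move: w'T; rewrite inE ew' eqxx orbT.
rewrite OE; have [ww'|ww'] := eqVneq w w'.
  have pal : rev (e w) = e w by rewrite /e -ew' -ww'.
  by rewrite -ww' setUid !big_set1 pal eqxx.
have npal : rev (e w) != e w.
  by apply: contraNneq ww' => pal; apply/eqP/T_words_inj => //; rewrite ew'.
rewrite !big_setU1 ?inE//= !big_set1 (negbTE npal) /e ew' revK eq_sym.
by rewrite -/(e w) (negbTE npal).
Qed.

(** A palindrome is determined by the first half of its run lengths, and each length has two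
    possible values. *)
Lemma card_Tp_words n : #|Tp_words n.+2| <= 2 ^ (uphalf n.+2).
Proof.
pose f (w : (n.+2.*2).-bseq bool) : (uphalf n.+2).-tuple bool :=
  [tuple nth 0 (run_lengths w) i == 2 | i < uphalf n.+2].
rewrite -[X in X ^ _]card_bool -card_tuple -(@card_in_imset _ _ f); first exact: max_card.
move=> w w'; rewrite !inE => /andP[wT /eqP wp] /andP[w'T /eqP w'p] ff.
apply: T_words_inj; rewrite ?inE//.
have sz : size (run_lengths w) = n.+2 by case/and5P: (wT) => /eqP.
have sz' : size (run_lengths w') = n.+2 by case/and5P: (w'T) => /eqP.
have half i : i < uphalf n.+2 -> nth 0 (run_lengths w) i = nth 0 (run_lengths w') i.
  move=> ih; have ic : i < n.+2 by apply: leq_trans ih _; lia.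
  have := congr1 (fun t => tnth t (Ordinal ih)) ff; rewrite !tnth_mktuple /=.
  have /(all_nthP 0)/(_ i) := T_run_lengths_one_or_two wT.
  have /(all_nthP 0)/(_ i) := T_run_lengths_one_or_two w'T.
  by rewrite sz sz' => /(_ ic) /orP[] /eqP -> /(_ ic) /orP[] /eqP ->.
apply: (@eq_from_nth _ 0) => [|i]; first by rewrite sz sz'.
rewrite sz => ic; have [/half//|hi] := ltnP i (uphalf n.+2).
rewrite -wp -w'p !nth_rev ?sz ?sz'//; apply: half.
by move: hi ic; lia.
Qed.

Local Open Scope ring_scope.

(** The bound 4 is 2 from [plat_signature_walk] plus 2 for the signs of the two forced letters. *)
Lemma T_signature n w : in_T n.+2 w ->
  `|knot_signature w - walk_sum (walk_code n w)| <= 4 :> int.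
Proof.
move=> wT; have [m [sm _ _ _ Lw]] := T_letters wT.
have := @plat_signature_walk (braid_word w) (T_coherent wT true) (T_coherent wT false)
  (fun _ => T_last_letter wT).
rewrite -/(knot_signature w) (walk_sum_deltas 3) {1}Lw /= -cats1 deltas_cat.
rewrite -(T_code sm Lw) /walk_sum big_cons big_cat /= big_seq1.
move: (knot_signature w) (\sum_(x <- _) _) => s1 s2.
by case: (_ (+) _); lia.
Qed.

(** * The central limit theorem for the simple random walk *)

From mathcomp Require Import all_classical all_reals all_analysis.

Import numFieldNormedType.Exports.

Local Open Scope classical_set_scope.
Local Open Scope ring_scope.

(** * The normal distribution function *)

Section Phi.
Context {R : realType}.
Implicit Types x t : R.

Definition gauss_density x : R := (Num.sqrt (2 * pi))^-1 * expR (- (x ^+ 2 / 2)).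

Lemma normal_pdf01 : normal_pdf 0 1 = gauss_density.
Proof.
apply/funext => x; rewrite normal_pdfE ?oner_neq0// /normal_peak /normal_fun.
rewrite /gauss_density subr0 expr1n mul1r -[pi *+ 2]mulr_natl -[1 *+ 2]/(2%:R).
by rewrite mulNr.
Qed.

Lemma integrable_gauss_density (A : set R) : measurable A ->
  lebesgue_measure.-integrable A (EFin \o gauss_density).
Proof.
move=> mA; apply: (integrableS measurableT) => //.
by have := @integrable_normal_pdf R 0 1; rewrite normal_pdf01.
Qed.

Lemma PhiE t : Phi t = \int[lebesgue_measure]_(x in `]-oo, t]) gauss_density x.
Proof.
have s0 : Num.sqrt (2 * pi) != 0 :> R.
  by rewrite gt_eqF// sqrtr_gt0 mulr_gt0// pi_gt0.
rewrite /Phi /gauss_density -RintegralZl//.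
have /integrableZl : lebesgue_measure.-integrable `]-oo, t] (EFin \o gauss_density).
  exact: integrable_gauss_density.
move=> /(_ (measurable_itv _) (Num.sqrt (2 * pi))).
apply: eq_integrable => // x _.
by rewrite /= /gauss_density -EFinM mulrA mulfV ?mul1r.
Qed.

Lemma Phi_normal_prob t : normal_prob 0 1 `]-oo, t] = (Phi t)%:E.
Proof.
rewrite PhiE /Rintegral fineK; first by rewrite -normal_pdf01.
have /integrable_fin_num : lebesgue_measure.-integrable `]-oo, t] (EFin \o gauss_density).
  exact: integrable_gauss_density.
exact.
Qed.

(** [Phi] is the distribution function of the identity under the standard normal law, which gives
    its monotonicity and its limits. *)
Let idTR : measurableTypeR R -> R := idfun.

#[local] HB.instance Definition _ :=
  @isMeasurableFun.Build _ _ _ _ idTR (@measurable_id _ _ setT).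

Let idRV : {RV (@normal_prob R 0 1) >-> R} := idTR.

Let cdf_idRV t : cdf idRV t = (Phi t)%:E.
Proof. by rewrite /cdf /distribution /pushforward /= preimage_id Phi_normal_prob. Qed.

Lemma Phi_ge0 t : 0 <= Phi t.
Proof. by rewrite -lee_fin -cdf_idRV cdf_ge0. Qed.

Lemma Phi_le1 t : Phi t <= 1.
Proof. by rewrite -lee_fin -cdf_idRV cdf_le1. Qed.

Lemma le_Phi (s t : R) : s <= t -> Phi s <= Phi t.
Proof. by move=> st; rewrite -lee_fin -!cdf_idRV cdf_nondecreasing. Qed.

Lemma cvg_Phiy : Phi t @[t --> +oo] --> (1 : R).
Proof.
have := cvg_cdfy1 idRV.
rewrite (_ : cdf idRV = EFin \o @Phi R); first by move/fine_cvgP => [].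
by apply/funext => t; rewrite cdf_idRV.
Qed.

Lemma cvg_PhiNy : Phi t @[t --> -oo] --> (0 : R).
Proof.
have := cvg_cdfNy0 idRV.
rewrite (_ : cdf idRV = EFin \o @Phi R); first by move/fine_cvgP => [].
by apply/funext => t; rewrite cdf_idRV.
Qed.

Lemma continuous_gauss_density : continuous gauss_density.
Proof. by rewrite -normal_pdf01; apply: continuous_normal_pdf; rewrite oner_neq0. Qed.

Lemma is_derive_Phi t : is_derive t 1 (@Phi R) (gauss_density t).
Proof.
have ltt : t < t + 1 by rewrite ltrDl.
have /= := @continuous_FTC1 R gauss_density -oo%O t (t + 1) ltt
  (integrable_gauss_density (measurable_itv _)) (ltNyr _)
  (@continuous_gauss_density t).
rewrite (_ : (fun _ => _) = @Phi R); last by apply/funext => x; rewrite PhiE.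
by rewrite derive1E => -[dP <-]; apply: DeriveDef.
Qed.

End Phi.

(** * One step of the walk and the heat equation *)

Section OneStep.
Context {R : realType}.
Implicit Types x y z : R.

Notation phi := (@gauss_density R).

Lemma gauss_density_bounds z :
  [/\ 0 <= phi z, phi z <= 1, z ^+ 2 * phi z <= 1 & z ^+ 4 * phi z <= 16].
Proof.
have pi2 : (2 : R) <= 2 * pi by have := @pi_ge2 R; lra.
have s1 : 1 <= Num.sqrt (2 * pi) :> R.
  by rewrite -[X in X <= _]sqrtr1 ler_sqrt; lra.
(* Since 1 + q is at most exp q, the density is at most the inverse square of 1 + q; the moments
   below are 4 q and 16 q^2 times the density. *)
set q := z ^+ 2 / 4; have q0 : 0 <= q by rewrite divr_ge0 ?sqr_ge0.
have e0 : 0 < expR (- (z ^+ 2 / 2)) :> R := expR_gt0 _.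
have eq : (1 + q) ^+ 2 * expR (- (z ^+ 2 / 2)) <= 1.
  rewrite expRN ler_pdivrMr ?expR_gt0// mul1r.
  rewrite (_ : z ^+ 2 / 2 = q + q); last by rewrite /q; field.
  rewrite expRD -expr2 ler_pXn2r ?nnegrE ?expR_ge0 ?expR_ge1Dx//.
  by rewrite addr_ge0.
have pe : phi z <= expR (- (z ^+ 2 / 2)).
  by rewrite /gauss_density ler_piMl ?expR_ge0// invf_le1// (lt_le_trans ltr01).
have p0 : 0 <= phi z by rewrite /gauss_density mulr_ge0 ?invr_ge0 ?sqrtr_ge0 ?ltW.
have zq : z ^+ 2 = 4 * q by rewrite /q; field.
have zq2 : z ^+ 4 = 16 * q ^+ 2 by rewrite -[4%N]/(2 * 2)%N exprM zq; ring.
rewrite zq2 zq; move: e0 eq pe; set e := expR _ => e0 eq pe.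
have e1 : 0 <= ((1 + q) ^+ 2 - 1) * e by rewrite mulr_ge0 ?(ltW e0)//; have := sqr_ge0 q; lra.
have e2 : 0 <= ((1 + q) ^+ 2 - 4 * q) * e.
  by rewrite mulr_ge0 ?(ltW e0)// (_ : _ - _ = (1 - q) ^+ 2) ?sqr_ge0//; ring.
have e3 : 0 <= ((1 + q) ^+ 2 - q ^+ 2) * e by rewrite mulr_ge0 ?(ltW e0)//; have := sqr_ge0 q; lra.
have e4 : 0 <= q * (e - phi z) by rewrite mulr_ge0// subr_ge0.
have e5 : 0 <= q ^+ 2 * (e - phi z) by rewrite mulr_ge0 ?sqr_ge0// subr_ge0.
move: e1 e2 e3 e4 e5; rewrite !mulrBl !mulrBr; set X := _ * e in eq *.
by move=> *; split => //; lra.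
Qed.

Lemma is_derive_gauss_density z : is_derive z 1 phi (- z * phi z).
Proof.
have -> : phi = (Num.sqrt (2 * pi))^-1 *: (expR \o (fun x => - 2^-1 * x ^+ 2)).
  apply/funext => x; rewrite /gauss_density fctE /=; congr (_ * expR _).
  by field.
apply: is_derive_eq; rewrite /gauss_density /=.
rewrite [X in _ *: X](_ : _ = expR (- (z ^+ 2 / 2)) * - z); last first.
  by rewrite /GRing.scale /=; congr (expR _ * _); field.
rewrite fctE /= /GRing.scale /= (_ : - 2^-1 * z ^+ 2 = - (z ^+ 2 / 2)).
  by rewrite mulrA mulrC.
by field.
Qed.

Lemma is_derive_bound (f df : R -> R) (M a b : R) : a <= b ->
  (forall x, a <= x <= b -> is_derive x 1 f (df x)) ->
  (forall x, a <= x <= b -> `|df x| <= M) ->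
  `|f b - f a| <= M * (b - a).
Proof.
move=> ab fd dfM.
have fI x : x \in `]a, b[ -> is_derive x 1 f (df x).
  by rewrite in_itv/= => /andP[/ltW ax /ltW xb]; apply: fd; rewrite ax.
have fc : {within `[a, b], continuous f}.
  apply: continuous_in_subspaceT => x /[!inE]/= /[!in_itv]/= xab.
  apply: differentiable_continuous; apply/derivable1_diffP.
  exact: (@ex_derive _ _ _ _ _ _ _ (fd x xab)).
have [c /[!in_itv]/= cab ->] := MVT_segment ab fI fc.
by rewrite normrM (ger0_norm (_ : 0 <= b - a)) ?subr_ge0// ler_wpM2r ?subr_ge0 ?dfM.
Qed.

(** [psi] and [dpsi] are the first and second derivatives of [phi]. *)
Let psi z : R := - z * phi z.
Let dpsi z : R := (z ^+ 2 - 1) * phi z.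

Let psi_le z : `|psi z| <= 1.
Proof.
have [p0 p1 p2 p4] := gauss_density_bounds z.
rewrite /psi normrM normrN (ger0_norm p0).
rewrite -(@ler_pXn2r _ 2)// ?nnegrE ?mulr_ge0// expr1n exprMn real_normK ?num_real//.
by rewrite [phi z ^+ 2]expr2 mulrA mulr_ile1// mulr_ge0// sqr_ge0.
Qed.

Let dpsi_le z : `|dpsi z| <= 2 /\ `|z * dpsi z| <= 18.
Proof.
have [p0 p1 p2 p4] := gauss_density_bounds z.
have z2 : 0 <= z ^+ 2 * phi z by rewrite mulr_ge0 ?sqr_ge0.
have z4 : 0 <= z ^+ 4 * phi z by rewrite mulr_ge0// -[4%N]/(2 * 2)%N exprM sqr_ge0.
have h1 : 0 <= (z - 1) ^+ 2 * phi z by rewrite mulr_ge0 ?sqr_ge0.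
have h2 : 0 <= (z + 1) ^+ 2 * phi z by rewrite mulr_ge0 ?sqr_ge0.
have h3 : 0 <= (z ^+ 2 - z) ^+ 2 * phi z by rewrite mulr_ge0 ?sqr_ge0.
have h4 : 0 <= (z ^+ 2 + z) ^+ 2 * phi z by rewrite mulr_ge0 ?sqr_ge0.
rewrite /dpsi; split; rewrite ler_norml; apply/andP; split; lra.
Qed.

Let is_derive_psi z : is_derive z 1 psi (dpsi z).
Proof.
rewrite /psi /dpsi.
have -> : (fun z => - z * phi z) = (-%R : R -> R) * phi by [].
have dphi := is_derive_gauss_density z.
by apply: is_derive_eq; rewrite /GRing.scale /=; ring.
Qed.

Let psi_lip y z : `|psi y - psi z| <= 2 * `|y - z|.
Proof.
wlog: y z / z <= y => [H|zy].
  have [/H//|/ltW/H] := leP z y.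
  by rewrite distrC [in X in _ <= X]distrC.
rewrite [X in _ * X]ger0_norm ?subr_ge0//.
apply: (@is_derive_bound _ dpsi) => // x _; exact: (dpsi_le x).1.
Qed.

(** The derivative in the dilation factor is controlled by w * dpsi w with w the dilated point, so
    the bound is uniform in [z]. *)
Let psi_dilate z r : 1 <= r -> `|psi (z * r) - psi z| <= 18 * (r - 1).
Proof.
move=> r1.
pose g x := psi (z * x).
rewrite -[X in _ - psi X]mulr1 -/(g r) -/(g 1).
apply: (@is_derive_bound _ (fun x => z * dpsi (z * x))) => // x /andP[x1 xr].
  have -> : g = psi \o (fun x => z * x) by [].
  have := is_derive_psi (z * x) => dp.
  have dm : is_derive x 1 (fun x => z * x) z.
    have -> : (fun x => z * x) = z *: (id : R -> R) by [].
    by apply: is_derive_eq; rewrite /GRing.scale /= mulr1.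
  by apply: is_derive_eq; rewrite mulrC.
apply: (le_trans _ (dpsi_le (z * x)).2).
rewrite [X in _ <= X]normrM normrM ler_wpM2r// normrM ler_peMr//.
by rewrite ger0_norm// (le_trans ler01).
Qed.

Let is_derive_translate (f df : R -> R) y x :
  is_derive (y + x) 1 f (df (y + x)) ->
  is_derive x 1 (fun x => f (y + x)) (df (y + x)).
Proof.
move=> fd; have -> : (fun x => f (y + x)) = f \o (cst y + id) by [].
by apply: is_derive_eq; rewrite add0r mulr1.
Qed.

Let is_derive_reflect (f df : R -> R) y x :
  is_derive (y - x) 1 f (df (y - x)) ->
  is_derive x 1 (fun x => f (y - x)) (- df (y - x)).
Proof.
move=> fd; have -> : (fun x => f (y - x)) = f \o (cst y - id) by [].
by apply: is_derive_eq; rewrite sub0r mulrN1.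
Qed.

Let sym_diff_phi (y t : R) : 0 <= t ->
  `|phi (y + t) - phi (y - t) - 2 * t * psi y| <= 4 * t ^+ 2.
Proof.
move=> t0.
pose f s := phi (y + s) - phi (y - s) - 2 * s * psi y.
have f0 : f 0 = 0 by rewrite /f addr0 subr0 subrr mulr0 mul0r subr0.
rewrite -/(f t) -[f t]subr0 -[X in _ - X]f0.
rewrite (_ : 4 * t ^+ 2 = (4 * t) * (t - 0)); last by ring.
apply: (@is_derive_bound _ (fun s => psi (y + s) + psi (y - s) - 2 * psi y)) => //.
  move=> s _.
  have d1 := is_derive_translate (df := psi) (is_derive_gauss_density (y + s)).
  have d2 := is_derive_reflect (df := psi) (is_derive_gauss_density (y - s)).
  have -> : f = (fun s => phi (y + s)) - (fun s => phi (y - s)) - (2 * psi y) *: id.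
    by apply/funext => x; rewrite /f !fctE /GRing.scale /=; ring.
  by apply: is_derive_eq; rewrite /GRing.scale /=; ring.
move=> s /andP[s0 st].
rewrite (_ : _ - _ = (psi (y + s) - psi y) + (psi (y - s) - psi y)); last by ring.
apply: (le_trans (ler_normD _ _)).
have := psi_lip (y + s) y; have := psi_lip (y - s) y.
rewrite !(addrC y) !addrK normrN (ger0_norm s0); lra.
Qed.

(** The defect of one step of length [t], with its derivative [dD] in [t]. As the defect vanishes at
    [t = 0], a quadratic bound on [dD] gives a cubic one on [D]. *)
Let D y t : R := 2^-1 * (Phi (y + t) + Phi (y - t)) - Phi (y / Num.sqrt (1 + t ^+ 2)).
Let dD y t : R := 2^-1 * (phi (y + t) - phi (y - t))
  - t * psi (y / Num.sqrt (1 + t ^+ 2)) / (1 + t ^+ 2).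

Let is_derive_D (y t : R) : is_derive t 1 (D y) (dD y t).
Proof.
have r0 : 0 < 1 + t ^+ 2 by rewrite ltr_pwDl// sqr_ge0.
have s0 : 0 < Num.sqrt (1 + t ^+ 2) by rewrite sqrtr_gt0.
have s2 : Num.sqrt (1 + t ^+ 2) ^+ 2 = 1 + t ^+ 2 by rewrite sqr_sqrtr// ltW.
have d1 := is_derive_translate (df := phi) (is_derive_Phi (y + t)).
have d2 := is_derive_reflect (df := phi) (is_derive_Phi (y - t)).
have d3 : is_derive t 1 (fun x : R => (Num.sqrt (1 + x ^+ 2))^-1)
    (- t / (1 + t ^+ 2) / Num.sqrt (1 + t ^+ 2)).
  have d4 := is_derive1_sqrt r0.
  have d5 : is_derive t 1 (fun x : R => Num.sqrt (1 + x ^+ 2))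
     (t / Num.sqrt (1 + t ^+ 2)).
    have -> : (fun x : R => Num.sqrt (1 + x ^+ 2)) = Num.sqrt \o (cst 1 + id ^+ 2 : R -> R).
      by [].
    apply: is_derive_eq; rewrite add0r /GRing.scale /=; field.
    by rewrite gt_eqF.
  apply: (is_derive_eq (is_deriveV _ _)); first by rewrite gt_eqF.
  rewrite /GRing.scale /= s2; field.
  by rewrite !gt_eqF.
have d6 := is_derive_Phi (y / Num.sqrt (1 + t ^+ 2)).
have -> : D y = 2^-1 *: ((fun s => Phi (y + s)) + (fun s => Phi (y - s)))
   - (@Phi R \o (y *: (fun x : R => (Num.sqrt (1 + x ^+ 2))^-1))) by [].
apply: is_derive_eq; rewrite /dD /psi /GRing.scale /=; field.
by rewrite !gt_eqF.
Qed.

(* [Phi (x / sqrt s)] solves the heat equation, so averaging over a step +-k amounts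
   to advancing the time s = 1 by k ^ 2. *)
Lemma Phi_one_step y k : 0 <= k ->
  `|2^-1 * (Phi (y + k) + Phi (y - k)) - Phi (y / Num.sqrt (1 + k ^+ 2))|
    <= 21 * k ^+ 3.
Proof.
move=> k0; rewrite -/(D y k).
(* For steps longer than 1 the bound is trivial, since [Phi] lies between 0 and 1. *)
have [k1|k1] := leP k 1; last first.
  have k3 : 1 <= k ^+ 3 by rewrite exprn_ege1// ltW.
  have := (@Phi_ge0 R (y + k), @Phi_le1 R (y + k), @Phi_ge0 R (y - k), @Phi_le1 R (y - k),
    @Phi_ge0 R (y / Num.sqrt (1 + k ^+ 2)), @Phi_le1 R (y / Num.sqrt (1 + k ^+ 2))).
  rewrite /D => -[[[[[? ?] ?] ?] ?] ?]; rewrite ler_norml; apply/andP; split; lra.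
have D0 : D y 0 = 0.
  by rewrite /D addr0 subr0 expr0n addr0 sqrtr1 divr1; lra.
rewrite -[D y k]subr0 -[X in _ - X]D0.
rewrite (_ : 21 * k ^+ 3 = 21 * k ^+ 2 * (k - 0)); last by ring.
apply: (@is_derive_bound _ (dD y)) => // t /andP[t0 tk].
set r := Num.sqrt (1 + t ^+ 2).
have t2 : 0 <= t ^+ 2 := sqr_ge0 t.
have r2 : r ^+ 2 = 1 + t ^+ 2 by rewrite sqr_sqrtr// addr_ge0.
have r0 : 0 <= r by rewrite sqrtr_ge0.
have r1 : 1 <= r by rewrite -(@ler_pXn2r _ 2)// ?nnegrE// r2 expr1n lerDl.
have rt : r - 1 <= t.
  by rewrite lerBlDr -(@ler_pXn2r _ 2)// ?nnegrE ?addr_ge0// r2 sqrrD expr1n; lra.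
have r0' : r != 0 by rewrite gt_eqF// (lt_le_trans ltr01).
have e1 := sym_diff_phi y t0.
have e2 := psi_dilate (y / r) r1; rewrite divfK// in e2.
have e3 : `|psi (y / r) * (1 - (r ^+ 2)^-1)| <= t ^+ 2.
  rewrite normrM -[X in _ <= X]mul1r; apply: ler_pM => //.
  have r21 : 1 <= r ^+ 2 by rewrite r2 lerDl.
  have i1 : (r ^+ 2)^-1 <= 1 by rewrite invf_le1// (lt_le_trans ltr01).
  rewrite ger0_norm ?subr_ge0//.
  have -> : 1 - (r ^+ 2)^-1 = t ^+ 2 * (r ^+ 2)^-1.
    by rewrite (_ : t ^+ 2 = r ^+ 2 - 1) ?r2; [field; rewrite -r2 expf_neq0|ring].
  by rewrite ler_piMr.
have -> : dD y t = 2^-1 * (phi (y + t) - phi (y - t) - 2 * t * psi y)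
    + t * (psi y - psi (y / r) + psi (y / r) * (1 - (r ^+ 2)^-1)).
  by rewrite /dD -/r -r2; field.
(* The symmetric difference gives 2, the dilation 18 and the change of scale 1, in units of
   [t ^+ 2]: in all 21. *)
apply: (@le_trans _ _ (2 * t ^+ 2 + t * (18 * t + t))); last first.
  have : t ^+ 2 <= k ^+ 2 by rewrite ler_pXn2r ?nnegrE// (le_trans t0).
  by move=> h; lra.
apply: (le_trans (ler_normD _ _)); apply: lerD.
  by rewrite normrM ger0_norm ?invr_ge0//; lra.
rewrite normrM (ger0_norm t0) ler_wpM2l//.
apply: (le_trans (ler_normD _ _)); apply: lerD; first lra.
by apply: (le_trans e3); rewrite expr2 ler_piMr// (le_trans tk).
Qed.

End OneStep.

(** * Convergence of the simple walk *)

Section RandomWalk.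
Context {R : realType}.
Implicit Types (f g : R -> R) (x a s t theta : R) (n : nat).

Fixpoint walk_avg n f x : R :=
  if n is m.+1 then 2^-1 * (walk_avg m f (x + 1) + walk_avg m f (x - 1)) else f x.

Lemma le_walk_avg n f g x : (forall y, f y <= g y) -> walk_avg n f x <= walk_avg n g x.
Proof.
move=> fg; elim: n x => //= n IH x.
by rewrite ler_wpM2l ?invr_ge0// lerD.
Qed.

Lemma walk_avgD_cst n f c x : walk_avg n (fun y => f y + c) x = walk_avg n f x + c.
Proof. by elim: n x => //= n IH x; rewrite !IH; field. Qed.

Lemma walk_avg_translate n f a x : walk_avg n (fun y => f (y + a)) x = walk_avg n f (x + a).
Proof. by elim: n x => //= n IH x; rewrite !IH addrAC [x - 1 + a]addrAC. Qed.

(** Each step raises the variance by 1. After rescaling to variance 1 its length is at most the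
    inverse root of [s], so the error of [Phi_one_step] is incurred at most [n] times. *)
Lemma walk_avg_Phi s a n x : 0 < s ->
  `|walk_avg n (fun y => Phi ((a - y) / Num.sqrt s)) x
    - Phi ((a - x) / Num.sqrt (s + n%:R))| <= n%:R * (21 * (Num.sqrt s)^-1 ^+ 3).
Proof.
move=> s0; elim: n x => [|n IH] x /=; first by rewrite addr0 subrr normr0 mul0r.
set W := walk_avg n _; set sn := s + n%:R.
have sn0 : 0 < sn by rewrite ltr_wpDr.
have r0 : 0 < Num.sqrt sn by rewrite sqrtr_gt0.
set k := (Num.sqrt sn)^-1; have k0 : 0 <= k by rewrite invr_ge0 ltW.
have := Phi_one_step ((a - x) * k) k0.
have -> : (a - x) * k + k = (a - (x - 1)) * k by ring.
have -> : (a - x) * k - k = (a - (x + 1)) * k by ring.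
have -> : (a - x) * k / Num.sqrt (1 + k ^+ 2) = (a - x) / Num.sqrt (s + n.+1%:R).
  rewrite -mulrA; congr (_ * _); rewrite /k -invfM -sqrtrM ?ltW//.
  rewrite exprVn sqr_sqrtr ?ltW// mulrDr mulr1 mulfV ?gt_eqF// /sn -addrA.
  by rewrite natr1.
move=> e1; have := IH (x + 1); have := IH (x - 1); rewrite -/W -/sn -/k => e2 e3.
have ks : 21 * k ^+ 3 <= 21 * (Num.sqrt s)^-1 ^+ 3.
  rewrite ler_wpM2l// lerXn2r ?nnegrE// ?invr_ge0 ?sqrtr_ge0//.
  rewrite /k lef_pV2 ?posrE ?sqrtr_gt0// ler_sqrt ?(ltW sn0)//.
  by rewrite /sn lerDl.
move: e1 e2 e3 ks; rewrite -[n.+1%:R]natr1 [(n%:R + 1) * _]mulrDl mul1r.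
do 3![move: (Phi _) => ?]; do 2![move: (W _) => ?].
move: (n%:R * _) (21 * k ^+ 3) (21 * _) => ? ? ?.
rewrite !ler_norml => /andP[? ?] /andP[? ?] /andP[? ?] ?.
by apply/andP; split; lra.
Qed.


(** After the shift by [e] the smooth profile is at least [Phi (e / Num.sqrt s)] on the half-line,
    so adding the missing constant dominates the indicator. *)
Lemma walk_avg_le_ub theta s e n x : 0 < s ->
  walk_avg n (fun y => (y <= theta)%R%:R) x <=
    Phi ((theta + e - x) / Num.sqrt (s + n%:R)) + (1 - Phi (e / Num.sqrt s))
    + n%:R * (21 * (Num.sqrt s)^-1 ^+ 3).
Proof.
move=> s0; set c := 1 - Phi _.
have := walk_avg_Phi (theta + e) n x s0.
rewrite ler_norml => /andP[_].
suff : walk_avg n (fun y => (y <= theta)%R%:R) x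
    <= walk_avg n (fun y => Phi ((theta + e - y) / Num.sqrt s) + c) x.
  by rewrite walk_avgD_cst; lra.
apply: le_walk_avg => y; have [yt|yt] /= := leP y theta.
  have : Phi (e / Num.sqrt s) <= Phi ((theta + e - y) / Num.sqrt s).
    by apply: le_Phi; rewrite ler_wpM2r ?invr_ge0 ?sqrtr_ge0//; lra.
  by rewrite /c; lra.
by rewrite addr_ge0 ?Phi_ge0// subr_ge0 Phi_le1.
Qed.

Lemma walk_avg_le_lb theta s e n x : 0 < s ->
  Phi ((theta - e - x) / Num.sqrt (s + n%:R)) - Phi (- e / Num.sqrt s)
    - n%:R * (21 * (Num.sqrt s)^-1 ^+ 3)
  <= walk_avg n (fun y => (y <= theta)%R%:R) x.
Proof.
move=> s0; set c := Phi (- e / _).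
have := walk_avg_Phi (theta - e) n x s0.
rewrite ler_norml => /andP[+ _].
suff : walk_avg n (fun y => Phi ((theta - e - y) / Num.sqrt s) - c) x
    <= walk_avg n (fun y => (y <= theta)%R%:R) x.
  by rewrite walk_avgD_cst; lra.
apply: le_walk_avg => y; have [yt|yt] /= := leP y theta.
  by have := (@Phi_le1 R ((theta - e - y) / Num.sqrt s), @Phi_ge0 R (- e / Num.sqrt s)) => -[]; rewrite -/c; lra.
rewrite subr_le0; apply: le_Phi; rewrite ler_wpM2r ?invr_ge0 ?sqrtr_ge0//; lra.
Qed.

(* The heat semigroup started at variance [d ^+ 4 * n] replaces the indicator
   of a half-line by a smooth function, up to a shift by [d * sqrt n]. *)
Lemma walk_avg_le_Phi (theta d : R) n x : (0 < n)%N -> 0 < d ->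
  let t := (theta - x) / Num.sqrt n%:R in
  let err := 21 * d^-1 ^+ 6 / Num.sqrt n%:R in
  Phi ((t - d) / Num.sqrt (1 + d ^+ 4)) - Phi (- d^-1) - err
    <= walk_avg n (fun y => (y <= theta)%R%:R) x /\
  walk_avg n (fun y => (y <= theta)%R%:R) x
    <= Phi ((t + d) / Num.sqrt (1 + d ^+ 4)) + (1 - Phi d^-1) + err.
Proof.
move=> n0 d0 t err.
have nR : 0 < n%:R :> R by rewrite ltr0n.
have sn0 : 0 < Num.sqrt n%:R :> R by rewrite sqrtr_gt0.
have snn : Num.sqrt n%:R ^+ 2 = n%:R :> R by rewrite sqr_sqrtr// ltW.
pose s := d ^+ 4 * n%:R; have s0 : 0 < s by rewrite mulr_gt0// exprn_gt0.
have ss : Num.sqrt s = d ^+ 2 * Num.sqrt n%:R.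
  by rewrite sqrtrM ?exprn_ge0 ?ltW// -[4%N]/(2 * 2)%N exprM sqrtr_sqr ger0_norm// sqr_ge0.
have ssn : Num.sqrt (s + n%:R) = Num.sqrt (1 + d ^+ 4) * Num.sqrt n%:R.
  by rewrite -sqrtrM ?addr_ge0 ?exprn_ge0 ?(ltW d0)//; congr Num.sqrt; rewrite /s; ring.
have d40 : Num.sqrt (1 + d ^+ 4) != 0.
  by rewrite gt_eqF// sqrtr_gt0 ltr_pwDl// exprn_ge0// ltW.
have errE : n%:R * (21 * (Num.sqrt s)^-1 ^+ 3) = err.
  rewrite ss /err; set S := Num.sqrt n%:R in sn0 snn *.
  by rewrite -snn; field; rewrite !gt_eqF.
have := walk_avg_le_lb theta (d * Num.sqrt n%:R) n x s0.
have := walk_avg_le_ub theta (d * Num.sqrt n%:R) n x s0.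
rewrite errE ssn ss.
have -> : (theta + d * Num.sqrt n%:R - x) / (Num.sqrt (1 + d ^+ 4) * Num.sqrt n%:R)
   = (t + d) / Num.sqrt (1 + d ^+ 4) by rewrite /t; field; rewrite d40 gt_eqF.
have -> : (theta - d * Num.sqrt n%:R - x) / (Num.sqrt (1 + d ^+ 4) * Num.sqrt n%:R)
   = (t - d) / Num.sqrt (1 + d ^+ 4) by rewrite /t; field; rewrite d40 gt_eqF.
have -> : - (d * Num.sqrt n%:R) / (d ^+ 2 * Num.sqrt n%:R) = - d^-1.
  by field; rewrite !gt_eqF.
have -> : d * Num.sqrt n%:R / (d ^+ 2 * Num.sqrt n%:R) = d^-1.
  by field; rewrite !gt_eqF.
by move=> -> ->.
Qed.

Lemma continuous_Phi : continuous (@Phi R).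
Proof.
move=> t; apply: differentiable_continuous; apply/derivable1_diffP.
exact: (@ex_derive _ _ _ _ _ _ _ (is_derive_Phi t)).
Qed.

Lemma cvg_sqrt_natr_pinfty : Num.sqrt n%:R @[n --> \oo] --> (+oo%R : set_system R).
Proof.
apply/cvgryPge => A.
near=> n.
apply: (@le_trans _ _ `|A|); first exact: ler_norm.
rewrite -[X in X <= _]sqrtr_sqr ler_sqrt//.
by near: n; exact: nbhs_infty_ger.
Unshelve. all: by end_near. Qed.

Lemma smoothed_Phi_cvg t :
  [/\ Phi ((t - d) / Num.sqrt (1 + d ^+ 4)) - Phi (- d^-1) @[d --> 0^'+] --> Phi t
    & Phi ((t + d) / Num.sqrt (1 + d ^+ 4)) + (1 - Phi d^-1) @[d --> 0^'+] --> Phi t].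
Proof.
have dv : d^-1 @[d --> 0^'+] --> (+oo%R : set_system R).
  apply/cvgrVy; last exact: cvg_within.
  exact: nbhs_right_gt.
have P1 : Phi d^-1 @[d --> 0^'+] --> (1 : R) by apply: (cvg_comp _ _ dv); exact: cvg_Phiy.
have P0 : Phi (- d^-1) @[d --> 0^'+] --> (0 : R).
  by apply: (cvg_comp (fun d : R => - d^-1) _ _ cvg_PhiNy); apply/cvgNrNy.
have d0 : d @[d --> 0^'+] --> (0 : R) by apply: cvg_within.
have sq : (Num.sqrt (1 + d ^+ 4))^-1 @[d --> 0^'+] --> (1 : R).
  rewrite -[X in _ --> X]invr1; apply: cvgV; first by rewrite oner_eq0.
  rewrite -[X in _ --> X]sqrtr1; 
  apply: (@cvg_comp _ _ _ (fun d : R => 1 + d ^+ 4) Num.sqrt _ (nbhs (1 : R)));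
    last exact: sqrt_continuous.
  suff : (1 + d ^+ 4) @[d --> 0^'+] --> (1 + 0 ^+ 4 : R) by rewrite expr0n addr0.
  by apply: cvgD; [exact: cvg_cst|apply: (@cvg_comp _ _ _ id (fun d : R => d ^+ 4) _ _ _ d0); exact: exprn_continuous].
split.
  rewrite -[X in _ --> X]subr0; apply: cvgB => //.
  apply: (continuous_cvg _ (@continuous_Phi t)).
  rewrite -[X in _ --> X]mulr1; apply: cvgM => //.
  by rewrite -[X in _ --> X]subr0; apply: cvgB => //; exact: cvg_cst.
rewrite -[X in _ --> X]addr0; apply: cvgD.
  apply: (continuous_cvg _ (@continuous_Phi t)).
  rewrite -[X in _ --> X]mulr1; apply: cvgM => //.
  by rewrite -[X in _ --> X]addr0; apply: cvgD => //; exact: cvg_cst.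
suff : 1 - Phi d^-1 @[d --> 0^'+] --> (1 - 1 : R) by rewrite subrr.
by apply: cvgB => //; exact: cvg_cst.
Qed.

Theorem walk_avg_cvg (theta : nat -> R) t :
  theta n / Num.sqrt n%:R @[n --> \oo] --> t ->
  walk_avg n (fun y => (y <= theta n)%R%:R) 0 @[n --> \oo] --> Phi t.
Proof.
move=> thetat; apply/cvgrPdist_le => /= e e0.
have [/cvgrPdist_lt lb /cvgrPdist_lt ub] := smoothed_Phi_cvg t.
have e2 : 0 < e / 4 by rewrite divr_gt0.
(* The smoothing width [d] is fixed first, and only then is [n] taken large. *)
have [d [d0 lbd ubd]] : exists d, [/\ 0 < d,
    `|Phi t - (Phi ((t - d) / Num.sqrt (1 + d ^+ 4)) - Phi (- d^-1))| < e / 4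
  & `|Phi t - (Phi ((t + d) / Num.sqrt (1 + d ^+ 4)) + (1 - Phi d^-1))| < e / 4].
  near (0 : R)^'+ => d; exists d; split; near: d.
  - exact: nbhs_right_gt.
  - exact: lb.
  - exact: ub.
have sV : (Num.sqrt n%:R)^-1 @[n --> \oo] --> (0 : R).
  apply/gtr0_cvgV0; last exact: cvg_sqrt_natr_pinfty.
  by near=> n; rewrite sqrtr_gt0 ltr0n; near: n; exact: nbhs_infty_gt.
have errc : 21 * d^-1 ^+ 6 / Num.sqrt n%:R @[n --> \oo] --> (0 : R).
  by rewrite -[X in _ --> X](mulr0 (21 * d^-1 ^+ 6)); apply: cvgM => //; exact: cvg_cst.
have cP c : Phi ((theta n / Num.sqrt n%:R + c) / Num.sqrt (1 + d ^+ 4)) @[n --> \oo]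
     --> Phi ((t + c) / Num.sqrt (1 + d ^+ 4)).
  apply: (continuous_cvg _ (@continuous_Phi _)).
  by apply: cvgM; [apply: cvgD => //; exact: cvg_cst|exact: cvg_cst].
have /cvgrPdist_lt cl := cP (- d); have /cvgrPdist_lt cu := cP d.
move/cvgrPdist_lt: errc => errc.
near=> n.
have n0 : (0 < n)%N by near: n; exact: nbhs_infty_gt.
have := walk_avg_le_Phi (theta n) 0 n0 d0; rewrite subr0 => -[].
have : `|0 - 21 * d^-1 ^+ 6 / Num.sqrt n%:R| < e / 4 by near: n; exact: errc.
have : `|Phi ((t - d) / Num.sqrt (1 + d ^+ 4)) -
   Phi ((theta n / Num.sqrt n%:R - d) / Num.sqrt (1 + d ^+ 4))| < e / 4.
  by near: n; exact: cl.
have : `|Phi ((t + d) / Num.sqrt (1 + d ^+ 4)) -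
   Phi ((theta n / Num.sqrt n%:R + d) / Num.sqrt (1 + d ^+ 4))| < e / 4.
  by near: n; exact: cu.
move: lbd ubd; move: (walk_avg _ _ _) (21 * _ / _) => ? ?.
do 7![move: (Phi _) => ?]; clear.
rewrite !ltr_norml => /andP[? ?] /andP[? ?] /andP[? ?] /andP[? ?] /andP[? ?].
by move=> ? ?; rewrite ler_norml; apply/andP; split; lra.
Unshelve. all: by end_near. Qed.

End RandomWalk.

(** * The distribution of the bridges of the clamped walk *)

Section ClampedWalk.
Context {R : realType}.
Implicit Types (f h : nat -> R -> R) (g : R -> R) (p n : nat) (x t : R).

Fixpoint clamp_avg n f p x : R :=
  if n is m.+1 then
    2^-1 * (clamp_avg m f (clamp_step p true) (x + 1)
            + clamp_avg m f (clamp_step p false) (x - 1))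
  else f p x.

Lemma walk_sum_cons b d : (walk_sum (b :: d))%:~R = (if b then 1 else -1) + (walk_sum d)%:~R :> R.
Proof. by rewrite /walk_sum big_cons rmorphD; case: b. Qed.

Lemma sum_tuple_cons n (F : seq bool -> R) :
  \sum_(d : n.+1.-tuple bool) F d = \sum_(b : bool) \sum_(d : n.-tuple bool) F (b :: d).
Proof.
rewrite pair_big /= (reindex (fun q : bool * n.-tuple bool => [tuple of q.1 :: q.2])) //=.
exists (fun d : n.+1.-tuple bool => (thead d, [tuple of behead d])) => [[b d] _|d _] /=.
  by congr (_, _); apply: val_inj.
by rewrite -tuple_eta.
Qed.

Lemma sum_clamped_walks n f p x :
  \sum_(d : n.-tuple bool) f (foldl clamp_step p d) (x + (walk_sum d)%:~R)
  = 2 ^+ n * clamp_avg n f p x.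
Proof.
elim: n p x => [|n IH] p x.
  rewrite (big_pred1 [tuple]) => [|d]; last by apply/esym/eqP; exact: tuple0.
  by rewrite /= /walk_sum big_nil addr0 expr0 mul1r.
rewrite (sum_tuple_cons _ (fun d => f (foldl clamp_step p d) (x + (walk_sum d)%:~R))).
rewrite big_bool /=; under eq_bigr do rewrite walk_sum_cons addrA.
under [X in _ + X]eq_bigr do rewrite walk_sum_cons addrA.
by rewrite !IH exprS; field.
Qed.

(* The transfer matrix of the clamped walk, with the position as a formal
   variable z, is annihilated by (M^2 - 1) (M - (z + 1/z)): beyond the free walk
   it only has the eigenvalues 1 and -1. *)
Lemma clamp_avg_annihilated n f p x : (p \in [:: 1; 2; 3])%N ->
  4 * clamp_avg n.+3 f p x - clamp_avg n.+1 f p x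
  = 2^-1 * ((4 * clamp_avg n.+2 f p (x + 1) - clamp_avg n f p (x + 1))
          + (4 * clamp_avg n.+2 f p (x - 1) - clamp_avg n f p (x - 1))).
Proof.
rewrite !inE /= => p3; set h := clamp_avg n f.
have K := (@addrK R, @subrK R).
by move: p3 => /or3P[] /eqP -> /=; rewrite !(addrK, subrK); field.
Qed.

(** By the annihilating relation, 4 times the average after n + 2 steps minus that after n steps
    evolves as a free walk average with initial value [g]. The 4 comes from halving at each of two
    steps. *)
Lemma clamp_avg_recurrence n f p g : (p \in [:: 1; 2; 3])%N ->
  (forall x, 4 * clamp_avg 2 f p x - f p x = g x) ->
  forall x, clamp_avg n.+2 f p x = 4^-1 * clamp_avg n f p x + 4^-1 * walk_avg n g x.
Proof.
move=> p3 fg.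
have H x : 4 * clamp_avg n.+2 f p x - clamp_avg n f p x = walk_avg n g x.
  elim: n x => [|n IH] x; first exact: fg.
  by rewrite clamp_avg_annihilated// !IH.
by move=> x; rewrite -H; field.
Qed.

Definition end_pos n : nat := if odd n then 3 else 1.
Definition end_shift n : R := if odd n then 2 else -2.

(** It remains to check two steps. For odd [n], the paths from 3 to 3 have sums 2 and 0, and the
    latter cancels against the subtracted term; for even [n], the only path from 3 to 1 has sum
    -2. *)
Lemma bridge_avg_recurrence n g x :
  clamp_avg n.+2 (fun p y => (p == end_pos n.+2)%:R * g y) 3 x
  = 4^-1 * clamp_avg n (fun p y => (p == end_pos n)%:R * g y) 3 x
    + 4^-1 * walk_avg n g (x + end_shift n).
Proof.
rewrite /end_pos [odd n.+2]/= negbK -walk_avg_translate.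
apply: clamp_avg_recurrence => // y; rewrite /end_shift.
have -> : y + (if odd n then 2 else -2) = if odd n then y + 1 + 1 else y - 1 - 1.
  by case: ifP => _; ring.
by case: (odd n) => /=; rewrite !(addrK, subrK); field.
Qed.


(** A class of thresholds stable under bounded perturbations and under shifts of the index, both of
    which the recurrence produces. *)
Definition near_sqrt t (theta : nat -> R) : Prop :=
  exists M, forall n, `|theta n - t * Num.sqrt n%:R| <= M.

Lemma sqrt_natrD n k :
  (Num.sqrt n%:R : R) <= (Num.sqrt (n + k)%:R : R) <= Num.sqrt n%:R + Num.sqrt k%:R.
Proof.
have s0 m : 0 <= Num.sqrt m%:R :> R by exact: sqrtr_ge0.
have s2 m : Num.sqrt m%:R ^+ 2 = m%:R :> R by rewrite sqr_sqrtr.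
apply/andP; split; first by rewrite ler_sqrt// ler_nat leq_addr.
rewrite -(@ler_pXn2r _ 2)// ?nnegrE ?addr_ge0// s2 sqrrD !s2 natrD.
by rewrite lerD2r lerDl mulrn_wge0// mulr_ge0.
Qed.

Lemma near_sqrt_shift t theta k : near_sqrt t theta -> near_sqrt t (fun n => theta (n + k)%N).
Proof.
move=> [M thM]; exists (M + `|t| * Num.sqrt k%:R) => n.
rewrite (_ : _ - _ = (theta (n + k)%N - t * Num.sqrt (n + k)%:R)
  + t * (Num.sqrt (n + k)%:R - Num.sqrt n%:R)); last by ring.
apply: (le_trans (ler_normD _ _)); rewrite lerD// normrM ler_wpM2l//.
have /andP[h1 h2] := sqrt_natrD n k.
by rewrite ger0_norm ?subr_ge0// lerBlDl.
Qed.

Lemma near_sqrtD t theta b M : near_sqrt t theta -> (forall n, `|b n| <= M) ->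
  near_sqrt t (fun n => theta n + b n).
Proof.
move=> [N thN] bM; exists (N + M) => n.
by rewrite addrAC; apply: (le_trans (ler_normD _ _)); rewrite lerD.
Qed.

Lemma near_sqrt_cvg t theta : near_sqrt t theta ->
  theta n / Num.sqrt n%:R @[n --> \oo] --> t.
Proof.
move=> [M thM]; apply/cvgrPdist_le => e e0; near=> n.
have n0 : 0 < n%:R :> R by rewrite ltr0n; near: n; exact: nbhs_infty_gt.
have s0 : 0 < Num.sqrt n%:R :> R by rewrite sqrtr_gt0.
rewrite distrC (_ : _ - _ = (theta n - t * Num.sqrt n%:R) / Num.sqrt n%:R); last first.
  by field; rewrite gt_eqF.
rewrite normrM normfV (gtr0_norm s0) ler_pdivrMr//; apply: (le_trans (thM n)).
rewrite -ler_pdivrMl//; near: n.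
by have /cvgryPge := @cvg_sqrt_natr_pinfty R; apply.
Unshelve. all: by end_near. Qed.

(** [L / 3] is the fixed point of u = u / 4 + L / 4, and each use of the recurrence divides the
    error of [a] by 4. All thresholds are treated at once because the index shift changes
    [theta]. *)
Lemma quarter_recurrence_cvg (a B : nat -> R -> R) (L t : R) :
  (forall n x, 0 <= a n x <= 1) -> 0 <= L <= 1 ->
  (forall n x, a n.+2 x = 4^-1 * a n x + 4^-1 * B n x) ->
  (forall theta, near_sqrt t theta -> B n (theta n) @[n --> \oo] --> L) ->
  forall theta, near_sqrt t theta -> a n (theta n) @[n --> \oo] --> L / 3.
Proof.
move=> a01 /andP[L0 L1] aS Bc.
have H k theta e : near_sqrt t theta -> 0 < e ->
    \forall n \near \oo, `|a n (theta n) - L / 3| <= 4^-1 ^+ k + e.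
  elim: k theta e => [|k IH] theta e tht e0.
    near=> n; rewrite expr0 ler_norml; have /andP[? ?] := a01 n (theta n).
    by apply/andP; split; lra.
  have tht' := @near_sqrt_shift t theta 2 tht.
  have [N1 _ aN] := IH _ _ tht' e0; have /cvgrPdist_le/(_ _ e0)[N2 _ BN] := Bc _ tht'.
  exists (maxn N1 N2 + 2)%N => // n /= Nn.
  rewrite -(subnK (leq_trans (leq_addl _ _) Nn)); set m := (n - 2)%N.
  have Nm : (maxn N1 N2 <= m)%N by rewrite /m; lia.
  have : `|L - B m (theta (m + 2)%N)| <= e by apply: BN => /=; lia.
  have : `|a m (theta (m + 2)%N) - L / 3| <= 4^-1 ^+ k + e by apply: aN => /=; lia.
  rewrite !addn2 aS exprS; have : 0 <= 4^-1 ^+ k :> R by rewrite exprn_ge0.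
  by move: (4^-1 ^+ k) => q q0; rewrite !ler_norml => /andP[? ?] /andP[? ?]; apply/andP; split; lra.
move=> theta tht; apply/cvgrPdist_le => e e0.
have [k ke] : exists k, 4^-1 ^+ k <= e / 2 :> R.
  have z1 : `|4^-1 : R| < 1 by rewrite ger0_norm ?invr_ge0// invf_lt1// ltr1n.
  have /cvgrPdist_le/(_ _ (divr_gt0 e0 (ltr0n R 2)))[N _ /(_ N (leqnn N)) /=] := cvg_expr z1.
  by rewrite sub0r normrN ger0_norm ?exprn_ge0 ?invr_ge0// => ?; exists N.
have := H k theta (e / 2) tht (divr_gt0 e0 (ltr0n R 2)).
apply: filterS => n; rewrite distrC => /le_trans; apply; lra.
Unshelve. all: by end_near. Qed.

End ClampedWalk.

(** * Counting words and knots *)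

Section Counting.
Context {R : realType}.

Definition bridge_avg n (g : R -> R) : R :=
  clamp_avg n (fun p y => (p == end_pos n)%:R * g y) 3 0.

Lemma bridge_avg_card n (P : pred R) :
  #|[set d in bridge_walks n | P (walk_sum d)%:~R]|%:R
  = 2 ^+ n * bridge_avg n (fun y => (P y)%:R).
Proof.
rewrite -sum_clamped_walks -sum1_card natr_sum big_mkcond /=.
apply: eq_bigr => d _; rewrite !inE add0r /end_pos.
by case: eqP => _ /=; rewrite ?mul0r ?mul1r//; case: (P _).
Qed.

Lemma clamp_avg_itv01 n (f : nat -> R -> R) p x : (forall p y, 0 <= f p y <= 1) ->
  0 <= clamp_avg n f p x <= 1.
Proof.
move=> f01; elim: n p x => [|n IH] p x //=.
have /andP[? ?] := IH (clamp_step p true) (x + 1).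
have /andP[? ?] := IH (clamp_step p false) (x - 1).
by apply/andP; split; lra.
Qed.

Lemma bridge_avg_itv01 n (P : pred R) : 0 <= bridge_avg n (fun y => (P y)%:R) <= 1.
Proof. by apply: clamp_avg_itv01 => p y; case: (_ == _); case: (P y) => /=; lra. Qed.

Lemma walk_avg1 n x : walk_avg n (fun=> 1) x = 1 :> R.
Proof. by elim: n x => //= n IH x; rewrite !IH; lra. Qed.

Lemma bridge_avg_cvg t (theta : nat -> R) : near_sqrt t theta ->
  bridge_avg n (fun y => (y <= theta n)%R%:R) @[n --> \oo] --> Phi t / 3.
Proof.
pose a n x := bridge_avg n (fun y => (y <= x)%R%:R).
pose B n x := walk_avg n (fun y => (y <= x)%R%:R) (0 + @end_shift R n).
apply: (@quarter_recurrence_cvg _ a B).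
- by move=> n x; apply: (bridge_avg_itv01 n (fun y => y <= x)).
- by rewrite Phi_ge0 Phi_le1.
- by move=> n x; rewrite /a /bridge_avg bridge_avg_recurrence.
move=> {}theta tht.
have -> : (fun n => B n (theta n))
    = (fun n => walk_avg n (fun y => (y <= theta n - end_shift n)%R%:R) 0).
  apply/funext => n; rewrite /B -walk_avg_translate; congr walk_avg.
  by apply/funext => y; rewrite lerBrDr.
apply: walk_avg_cvg; apply: near_sqrt_cvg.
apply: (@near_sqrtD _ _ _ _ 2 tht) => n.
by rewrite normrN /end_shift; case: ifP; rewrite ?normrN ger0_norm.
Qed.

Lemma bridge_total_cvg : bridge_avg n (fun=> 1) @[n --> \oo] --> (3^-1 : R).
Proof.
rewrite -[X in _ --> X]mul1r.
pose a n (x : R) : R := bridge_avg n (fun=> 1).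
apply: (@quarter_recurrence_cvg _ a (fun _ _ => 1) 1 0 _ _ _ _ (fun=> 0)).
- by move=> n x; have := bridge_avg_itv01 n xpredT.
- by rewrite ler01 lexx.
- by move=> n x; rewrite /a /bridge_avg bridge_avg_recurrence walk_avg1.
- by move=> *; exact: cvg_cst.
- by exists 0 => n; rewrite mul0r subrr normr0.
Qed.

Lemma k_leE c (x : R) : k_le c x =
  (#|[set w in T_words c | (knot_signature w)%:~R <= x]|
   + #|[set w in Tp_words c | (knot_signature w)%:~R <= x]|)%:R / 2.
Proof.
(* All signatures that occur are in this finite list, so the sum over the integers reduces to it. *)
pose r := undup [seq knot_signature (val w) | w <- enum {: (c.*2).-bseq bool}].
have rP (w : (c.*2).-bseq bool) : knot_signature w \in r.
  by rewrite mem_undup; apply: (map_f (fun w : (c.*2).-bseq bool => knot_signature w)); rewrite mem_enum.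
rewrite /k_le -[X in \sum_(_ \in X) _]/[set` (fun sigma : int => sigma%:~R <= x)].
rewrite -(@bigfs _ _ _ _ r) ?undup_uniq//; last first.
  move=> s _ sr; rewrite /k_count /s_count /sp_count.
  have c0 (A : {set (c.*2).-bseq bool}) : #|[set w in A | knot_signature w == s]| = 0%N.
    apply: eq_card0 => w; rewrite inE; apply: contraNF sr => /andP[_ /eqP <-].
    exact: rP.
  by rewrite !c0 mul0r.
have H (A : {set (c.*2).-bseq bool}) :
    #|[set w in A | (knot_signature w)%:~R <= x]|%:R =
    \sum_(s <- r | s%:~R <= x) #|[set w in A | knot_signature w == s]|%:R :> R.
  transitivity (\sum_(w in A) \sum_(s <- r | s%:~R <= x) (knot_signature w == s)%:R : R).
    rewrite -sum1_card natr_sum (eq_bigl (fun w => (w \in A) && ((knot_signature w)%:~R <= x))).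
      rewrite big_mkcondr; apply: eq_bigr => w wA.
      rewrite [RHS]big_mkcond (bigD1_seq (knot_signature w)) ?undup_uniq//= eqxx.
      rewrite big1 ?addr0//.
      by move=> s /negbTE sw; case: (s%:~R <= x) => //; rewrite eq_sym sw.
    by move=> w; rewrite inE.
  rewrite exchange_big; apply: eq_bigr => s _.
  rewrite -sum1_card natr_sum big_mkcond [RHS]big_mkcond; apply: eq_bigr => w _.
  by rewrite inE; case: (w \in A); case: eqP.
by rewrite natrD !H -big_split /= mulr_suml; apply: eq_bigr => s _; rewrite /k_count natrD.
Qed.


Lemma card_T_words_code n (P : pred R) :
  #|[set w in T_words n.+2 | P (walk_sum (walk_code n w))%:~R]|%:R
  = 2 ^+ n * bridge_avg n (fun y => (P y)%:R).
Proof. by rewrite (card_T_code (fun d => P (walk_sum d)%:~R)) bridge_avg_card. Qed.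

Lemma T_words_signature_bounds n (x : R) :
  bridge_avg n (fun y => (y <= x - 4)%R%:R)
    <= #|[set w in T_words n.+2 | (knot_signature w)%:~R <= x]|%:R / 2 ^+ n
    <= bridge_avg n (fun y => (y <= x + 4)%R%:R).
Proof.
have two_n : 0 < 2 ^+ n :> R by rewrite exprn_gt0.
rewrite ler_pdivlMr// ler_pdivrMr// ![bridge_avg _ _ * _]mulrC.
rewrite -!(card_T_words_code _ (fun y => y <= _)) !ler_nat.
have near_sum w : in_T n.+2 w ->
    `|(knot_signature w)%:~R - (walk_sum (walk_code n w))%:~R| <= 4 :> R.
  by move=> /T_signature; rewrite -rmorphB -intr_norm -(ler_int R).
apply/andP; split; apply: subset_leq_card; apply/fintype.subsetP => w; rewrite !inE => /andP[wT].
  by rewrite wT => h; have := near_sum _ wT; rewrite ler_norml => /andP[? ?] /=; lra.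
by rewrite wT => h; have := near_sum _ wT; rewrite ler_norml => /andP[? ?] /=; lra.
Qed.

Lemma T_words_cvg : #|T_words n.+2|%:R / 2 ^+ n @[n --> \oo] --> (3^-1 : R).
Proof.
rewrite (_ : (fun n => _) = (fun n => bridge_avg n (fun=> 1))); first exact: bridge_total_cvg.
apply/funext => n.
have := card_T_words_code n xpredT; rewrite (_ : [set w in _ | _] = T_words n.+2).
  by move=> ->; rewrite mulrC mulKf// expf_neq0.
by apply/setP => w; rewrite inE andbT.
Qed.

Lemma Tp_words_cvg : #|Tp_words n.+2|%:R / 2 ^+ n @[n --> \oo] --> (0 : R).
Proof.
have z1 : `|2^-1 : R| < 1 by rewrite ger0_norm ?invr_ge0// invf_lt1// ltr1n.
apply/cvgrPdist_le => e e0.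
have e2 : 0 < e / 2 by rewrite divr_gt0.
have /cvgrPdist_le/(_ _ e2)[N _ HN] := cvg_expr z1.
exists N.*2 => // n /= Nn; rewrite sub0r normrN ger0_norm ?divr_ge0 ?exprn_ge0//.
have := HN n./2 (_ : (N <= n./2)%N); rewrite sub0r normrN ger0_norm ?exprn_ge0 ?invr_ge0//.
move=> /(_ _)/wrap[|h]; first by lia.
apply: (@le_trans _ _ (2 * (2^-1 ^+ n./2))); last by lra.
rewrite ler_pdivrMr ?exprn_gt0//.
have -> : 2 * 2^-1 ^+ n./2 * 2 ^+ n = 2 ^+ (uphalf n.+2) :> R.
  have -> : 2 ^+ n = 2 ^+ n./2 * 2 ^+ uphalf n :> R.
    by rewrite -exprD; congr (_ ^+ _); lia.
  by rewrite -[uphalf n.+2]/(uphalf n).+1 exprS exprVn; field; rewrite expf_neq0.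
by rewrite -natrX ler_nat; exact: card_Tp_words.
Qed.

End Counting.

Theorem theorem1p1 (R : realType) (t : R) :
  (fun c : nat => k_le c (t * Num.sqrt c%:R) / #|K_knots c|%:R)
    @ \oo --> Phi t.
Proof.
(* The words with n + 2 runs correspond to walks of length n, so all counts are divided by
   [2 ^+ n]. *)
rewrite -(cvg_shiftn 2) /=.
pose S n : R := #|[set w in T_words n.+2 |
  (knot_signature w)%:~R <= t * Num.sqrt (n + 2)%:R]|%:R / 2 ^+ n.
pose Sp n : R := #|[set w in Tp_words n.+2 |
  (knot_signature w)%:~R <= t * Num.sqrt (n + 2)%:R]|%:R / 2 ^+ n.
have near_t : near_sqrt t (fun n => t * Num.sqrt (n + 2)%:R).
  apply: (@near_sqrt_shift _ _ (fun n => t * Num.sqrt n%:R)).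
  by exists 0 => n; rewrite subrr normr0.
have cS : S n @[n --> \oo] --> Phi t / 3.
  apply: (@squeeze_cvgr _ _ _ _
    (fun n => bridge_avg n (fun y => (y <= t * Num.sqrt (n + 2)%:R - 4)%R%:R))
    (fun n => bridge_avg n (fun y => (y <= t * Num.sqrt (n + 2)%:R + 4)%R%:R))).
  - by apply: nearW => n; exact: T_words_signature_bounds.
  - by apply: bridge_avg_cvg; apply: (near_sqrtD near_t) => n; rewrite normrN ger0_norm.
  - by apply: bridge_avg_cvg; apply: (near_sqrtD near_t) => n; rewrite ger0_norm.
have cSp : Sp n @[n --> \oo] --> (0 : R).
  apply: (@squeeze_cvgr _ _ _ _ (fun=> 0) (fun n => #|Tp_words n.+2|%:R / 2 ^+ n)).
  - apply: nearW => n; rewrite divr_ge0 ?exprn_ge0//= ler_wpM2r ?invr_ge0 ?exprn_ge0// ler_nat.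
    by apply: subset_leq_card; apply/fintype.subsetP => w; rewrite inE => /andP[].
  - exact: cvg_cst.
  - exact: Tp_words_cvg.
have -> : Phi t = (Phi t / 3 + 0) / (3^-1 + 0) by field.
have cD : (#|T_words n.+2|%:R / 2 ^+ n + #|Tp_words n.+2|%:R / 2 ^+ n)^-1 @[n --> \oo]
    --> ((3^-1 + 0)^-1 : R).
  apply: cvgV; first by rewrite addr0 invr_eq0.
  by apply: cvgD; [exact: T_words_cvg|exact: Tp_words_cvg].
rewrite (_ : (fun n => _) = (fun n => (S n + Sp n) *
    (#|T_words n.+2|%:R / 2 ^+ n + #|Tp_words n.+2|%:R / 2 ^+ n)^-1)).
  exact: cvgM (cvgD cS cSp) cD.
apply/funext => n /=.
rewrite addn2 k_leE /S /Sp addn2.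
have two_n : 2 ^+ n != 0 :> R by rewrite expf_neq0.
have K2 : #|K_knots n.+2|%:R * 2 = (#|T_words n.+2| + #|Tp_words n.+2|)%:R :> R.
  by rewrite -natrM muln2 card_K_knots.
rewrite -!mulrDl -!natrD -K2.
(* With no knots both sides are 0, the inverse of 0 being 0. *)
have [->|K0] := eqVneq (#|K_knots n.+2|%:R : R) 0.
  by rewrite !mul0r invr0 !mulr0.
by field; rewrite two_n K0.
Qed.
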